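(* Let $n,d\in\mathbb N$, $q\in(-\infty,1)$, and let $\mathcal X=\{x\in\mathbb R^n: g_j(x)\geq 0,\ j=1,\dots,m\}$ be a compact basic semi-algebraic set with nonempty interior, where $g_1,\dots,g_m\in\mathbb R[x]$ and one of the $g_j$ is of the form $R^2-\sum_{i=1}^n x_i^2$. Let $\rho$ be the optimal value and $\mathbf y^\star=(y^\star_\alpha)_{|\alpha|\le 2d}$ the unique optimal solution of the ideal problem $\max\{\phi_q(M_d(\mathbf y)) : \mathbf y\in\mathcal M_{2d}(\mathcal X),\ y_0=1\}$, and let $p^\star_d(x):=\mathbf v_d(x)^\top M_d(\mathbf y^\star)^{q-1}\mathbf v_d(x)$. For every $\delta=0,1,2,\dots$ let $\mathbf y^\star_{d,\delta}$ be an optimal solution, with optimal value $\rho_\delta$, of the relaxation $\max\{\phi_q(M_d(\mathbf y)) : \mathbf y\in\mathcal M^{\mathsf{SDP}}_{2(d+\delta)}(\mathcal X),\ y_0=1\}$, and let $p^\star_{d,\delta}(x):=\mathbf v_d(x)^\top M_d(\mathbf y^\star_{d,\delta})^{q-1}\mathbf v_d(x)$. Then: (a) $\rho_\delta\to\rho$ as $\delta\to\infty$; (b) for every $\alpha\in\mathbb N^n$ with $|\alpha|\le 2d$, $\lim_{\delta\to\infty}y^\star_{d,\delta,\alpha}=y^\star_\alpha$; (c) $p^\star_{d,\delta}\to p^\star_d$ (coefficientwise) as $\delta\to\infty$; (d) if the polynomial $p^\star:=\mathrm{trace}(M_d(\mathbf y^\star)^q)-p^\star_d$ belongs to $\mathcal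 P^{\mathsf{SOS}}_{2(d+\delta)}(\mathcal X)$ for some $\delta$, then finite convergence takes place: $\mathbf y^\star_{d,\delta}$ is the unique optimal solution of the ideal problem (i.e. equals $\mathbf y^\star$) and it has a representing measure, namely the optimal design measure whose moments up to order $2d$ are $\mathbf y^\star$.
   Context: $s(k):=\binom{n+k}{n}$. $\mathbf v_k(x)$ is the vector of monomials $x^\alpha$, $|\alpha|\le k$. The moment matrix $M_k(\mathbf y)$ has entries $y_{\alpha+\beta}$, $|\alpha|,|\beta|\le k$; the localizing matrix of $f=\sum_\gamma f_\gamma x^\gamma$ is $M_k(f\mathbf y)(\alpha,\beta)=\sum_\gamma f_\gamma y_{\gamma+\alpha+\beta}$. $\mathcal M_{2d}(\mathcal X)$ is the set of $\mathbf y\in\mathbb R^{s(2d)}$ such that $y_\alpha=\int_{\mathcal X}x^\alpha d\mu$ for all $|\alpha|\le 2d$ for some nonnegative Borel measure $\mu$ on $\mathcal X$ (a representing measure). Let $v_j:=\lceil\deg(g_j)/2\rceil$. $\mathcal M^{\mathsf{SDP}}_{2(d+\delta)}(\mathcal X)$ is the set of $\mathbf y\in\mathbb R^{s(2d)}$ for which there is $\mathbf y_\delta\in\mathbb R^{s(2(d+\delta))}$ with truncation $(y_{\delta,\alpha})_{|\alpha|\le 2d}=\mathbf y$, $M_{d+\delta}(\mathbf y_\delta)\succeq 0$ and $M_{d+\delta-v_j}(g_j\mathbf y_\delta)\succeq0$, $j=1,\dots,m$. $\mathcal P^{\mathsf{SOS}}_{2(d+\delta)}(\mathcal X)$ is the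 set of polynomials $h$ of degree at most $2d$ with $h=\sigma_0+\sum_j g_j\sigma_j$, $\sigma_0$ a sum of squares of polynomials of degree $\le d+\delta$, $\sigma_j$ a sum of squares of polynomials of degree $\le d+\delta-v_j$. Kiefer's criterion on $p\times p$ positive semidefinite matrices ($p=s(d)$): for positive definite $M$, $\phi_q(M)=(\frac1p\mathrm{trace}(M^q))^{1/q}$ ($q\ne 0$), $\phi_0(M)=\det(M)^{1/p}$; for singular $M$, $\phi_q(M)=(\frac1p\mathrm{trace}M^q)^{1/q}$ if $q\in(0,1]$ and $0$ if $q\le 0$. It is known that the ideal problem has a unique optimal solution $\mathbf y^\star$ and that $M_d(\mathbf y^\star)$ and each $M_d(\mathbf y^\star_{d,\delta})$ are positive definite. *)

(* Defs.v *)
From HB Require Import structures.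
From mathcomp Require Import all_boot all_order all_algebra.
From mathcomp Require Import all_classical all_reals all_analysis.
From mathcomp Require mpoly.
(* import mpoly's canonical instances/coercions but not its notations
   (which clash with MathComp-Analysis) *)
Import -(notations) mpoly.

Set Implicit Arguments.
Unset Strict Implicit.
Unset Printing Implicit Defensive.

Import numFieldNormedType.Exports.
Import Order.TTheory GRing.Theory Num.Theory.
Local Open Scope ring_scope.
Local Open Scope classical_set_scope.

(* Exponents alpha in N^n are mpoly.multinom n; |alpha| = mpoly.mdeg. *)
(* The monomials x^alpha with |alpha| <= k are the finite type        *)
(* mpoly.bmultinom n k.+1 (those of degree < k+1); there are          *)
(* s(k) = binom(n+k, n) of them.  Moment/localizing matrices of order  *)
(* k are indexed by 'I_(smon n k) through a fixed enumeration.         *)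

Definition smon (n k : nat) : nat := #|{: mpoly.bmultinom n k.+1}|.

Definition midx (n k : nat) (i : 'I_(smon n k)) : mpoly.multinom n :=
  mpoly.bmnm (enum_val i).

(* pseudo-moment sequences: y_alpha for every alpha (only the entries
   with |alpha| <= 2d are ever relevant) *)
Definition mseq (R : Type) (n : nat) := mpoly.multinom n -> R.

Definition momentmx (R : nzRingType) (n k : nat) (y : mseq R n)
  : 'M[R]_(smon n k) :=
  \matrix_(i, j) y (mpoly.mnm_add (midx i) (midx j)).

Definition locmx (R : nzRingType) (n k : nat) (f : mpoly.mpoly n R) (y : mseq R n)
  : 'M[R]_(smon n k) :=
  \matrix_(i, j) \sum_(g <- mpoly.msupp f)
      mpoly.mcoeff g f * y (mpoly.mnm_add g (mpoly.mnm_add (midx i) (midx j))).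

(* total degree of a polynomial (deg 0 := 0) *)
Definition pdeg (R : nzRingType) (n : nat) (f : mpoly.mpoly n R) : nat :=
  (mpoly.msize f).-1.

Definition vhalf (R : nzRingType) (n : nat) (f : mpoly.mpoly n R) : nat :=
  uphalf (pdeg f).

Definition psdmx (R : realType) (m : nat) (A : 'M[R]_m) : Prop :=
  A^T = A /\ forall v : 'cV[R]_m, 0 <= (v^T *m A *m v) 0 0.

Definition pdmx (R : realType) (m : nat) (A : 'M[R]_m) : Prop :=
  A^T = A /\ forall v : 'cV[R]_m, v != 0 -> 0 < (v^T *m A *m v) 0 0.

(* Real power M^r of a positive semidefinite matrix, defined through an
   orthogonal diagonalisation M = U diag(l) U^T with l >= 0:
   M^r := U diag(l_i^r) U^T (with 0^r = 0 for r <> 0, as in powR).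
   (Independent of the chosen diagonalisation.)  Returns 0 when M has
   no such diagonalisation (i.e. is not PSD); never used in that case. *)
Definition orth_diag (R : realType) (m : nat) (A : 'M[R]_m)
    (UL : 'M[R]_m * 'rV[R]_m) : Prop :=
  UL.1^T *m UL.1 = 1%:M /\ A = UL.1 *m diag_mx UL.2 *m UL.1^T /\
  (forall i, 0 <= UL.2 0 i).

Definition mxpowr (R : realType) (m : nat) (A : 'M[R]_m) (r : R) : 'M[R]_m :=
  match pselect (exists UL, orth_diag A UL) with
  | left h => let UL := proj1_sig (cid h) in
      UL.1 *m diag_mx (\row_i powR (UL.2 0 i) r) *m UL.1^T
  | right _ => 0
  end.

Definition phiq (R : realType) (m : nat) (q : R) (A : 'M[R]_m) : R :=
  if q == 0 then powR (\det A) (m%:R^-1)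
  else if (A \in unitmx) || (0 < q)
       then powR (\tr (mxpowr A q) / m%:R) (q^-1)
       else 0.

Definition peval (R : realType) (n : nat) (f : mpoly.mpoly n R) (x : 'rV[R]_n) : R :=
  mpoly.meval (fun i => x 0 i) f.

Definition xmono (R : realType) (n : nat) (a : mpoly.multinom n) (x : 'rV[R]_n) : R :=
  \prod_(i < n) x 0 i ^+ a i.

Definition semialg (R : realType) (n m : nat) (g : 'I_m -> mpoly.mpoly n R)
  : set 'rV[R]_n :=
  [set x | forall j, 0 <= peval (g j) x].

Definition borelRn (R : realType) (n : nat) :=
  g_sigma_algebraType (@open 'rV[R]_n).

Definition is_moment_seq (R : realType) (n : nat) (X : set 'rV[R]_n) (d : nat)
    (y : mseq R n) : Prop :=
  exists mu : {measure set (borelRn R n) -> \bar R},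
    forall a : mpoly.multinom n, (mpoly.mdeg a <= 2 * d)%N ->
      ((y a)%:E = \int[mu]_(x in (X : set (borelRn R n))) (xmono a x)%:E)%E.

Definition sdp_feasible (R : realType) (n m : nat) (g : 'I_m -> mpoly.mpoly n R)
    (d delta : nat) (y : mseq R n) : Prop :=
  exists yd : mseq R n,
    (forall a, (mpoly.mdeg a <= 2 * d)%N -> yd a = y a) /\
    psdmx (momentmx (d + delta) yd) /\
    forall j, (vhalf (g j) <= d + delta)%N ->
      psdmx (locmx (d + delta - vhalf (g j)) (g j) yd).

Definition sos_deg (R : nzRingType) (n k : nat) (s : mpoly.mpoly n R) : Prop :=
  exists hs : seq (mpoly.mpoly n R),
    (forall h, h \in hs -> (mpoly.msize h <= k.+1)%N) /\
    s = \sum_(h <- hs) h ^+ 2.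

Definition in_Psos (R : nzRingType) (n m : nat) (g : 'I_m -> mpoly.mpoly n R)
    (d delta : nat) (h : mpoly.mpoly n R) : Prop :=
  (mpoly.msize h <= (2 * d).+1)%N /\
  exists (s0 : mpoly.mpoly n R) (s : 'I_m -> mpoly.mpoly n R),
    sos_deg (d + delta) s0 /\
    (forall j, if (vhalf (g j) <= d + delta)%N
               then sos_deg (d + delta - vhalf (g j)) (s j)
               else s j = 0) /\
    h = s0 + \sum_(j < m) g j * s j.

Definition quadpoly (R : nzRingType) (n k : nat) (A : 'M[R]_(smon n k))
  : mpoly.mpoly n R :=
  \sum_(i < smon n k) \sum_(j < smon n k)
     A i j *: (mpoly.mpolyX R (midx i) * mpoly.mpolyX R (midx j)).

Definition normalized (R : nzRingType) (n : nat) (y : mseq R n) : Prop :=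
  y (mpoly.mnm0) = 1.

(* Main.v *)
(* Fix an ultrafilter U on nat finer than the eventual filter: bounded sequences
   converge along U, and a sequence converges to l as soon as it does so along every
   such U.  The ball constraint bounds the moments of the relaxations, so along U
   they converge to a state: a normalised linear functional L on polynomials that
   is nonnegative on squares and on each g_j times squares.

   States are represented on X (Putinar's theorem in dual form).  Multiplication
   by rho + x_i and rho - x_i preserves the cone of states, because a functional
   that is nonnegative on squares and has geometrically growing moments satisfies
   L(x_i^2 s^2) <= rho^2 L(s^2) by log-convexity.  Hence an extreme state is
   multiplicative, i.e. the evaluation at a point of X, and a polynomial that is
   nonnegative on X has nonnegative value at every state.  A closest-point argument
   in the (compact, by Caratheodory) convex hull of the moment curve over X then
   makes the truncation of any state the moments of a finitely atomic measure.

   On positive definite matrices phi_q is an increasing function of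
   F = tr(M^q)/q (or log det M), which obeys the strict tangent inequality
   F(B) <= F(A) + tr(A^(q-1) (B - A)).  By concavity the midpoint of the limit and
   ystar is optimal for the ideal problem, so uniqueness identifies the limit with
   ystar.  Using midpoints keeps the matrices positive definite, so phi_q is never
   needed near singular matrices.  For (d), the certificate gives
   tr(S^(q-1) (M - S)) <= 0 for S = M_d(ystar), which forces equality in the tangent inequality. *)
Require Import Defs.
From HB Require Import structures.
From mathcomp Require Import all_boot all_order all_algebra.
From mathcomp Require Import all_classical all_reals all_analysis.
From mathcomp Require Import lra ring.
From mathcomp Require mpoly.
Import -(notations) mpoly.
Import numFieldNormedType.Exports.
Import Order.TTheory GRing.Theory Num.Theory.
Local Open Scope ring_scope.
Local Open Scope classical_set_scope.
Set Implicit Arguments.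
Unset Strict Implicit.
Unset Printing Implicit Defensive.

(** * Limits along ultrafilters *)

(** An ultrafilter contains either the preimage of [V] or its complement, so a cluster point of the
    image filter is already a limit. *)
Lemma cvg_ultra_compact (T : topologicalType) (U : set_system nat) {UU : UltraFilter U}
    (A : set T) (u : nat -> T) : compact A -> U [set k | A (u k)] ->
  exists l, A l /\ u @ U --> l.
Proof.
move=> /(_ (u @ U) _) cA uA; have [|l [Al cl]] := cA _; first exact: uA.
exists l; split=> // V Vl; have [//|UnV] := in_ultra_setVsetC (u @^-1` V) UU.
by have [x []] := cl (~` V) V UnV Vl.
Qed.

Lemma cvg_ultra_bounded (R : realType) (U : set_system nat) {UU : UltraFilter U}
    (u : nat -> R) (M : R) :
  U [set k | `|u k| <= M] -> exists l : R, u @ U --> l.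
Proof.
move=> UM; have uM : U [set k | `[- M, M]%classic (u k)].
  by apply: filterS UM => k /=; rewrite in_itv /= ler_norml.
by have [l [_ ul]] := cvg_ultra_compact (@segment_compact R (- M) M) uM; exists l.
Qed.

(** If [u] left [V] infinitely often, the eventual filter restricted to those indices would be
    proper; an ultrafilter extending it would contradict convergence along it. *)
Lemma cvg_ultra_infty (R : realType) (u : nat -> R) (l : R) :
  (forall U : set_system nat, UltraFilter U -> \oo `<=` U -> u @ U --> l) ->
  u @ \oo --> l.
Proof.
move=> ul V Vl; apply: contrapT => nV.
have PF : ProperFilter (within (~` (u @^-1` V)) \oo).
  apply: Build_ProperFilter => w0; apply: nV; rewrite /fmap /=.
  have : \oo [set k | (~` (u @^-1` V)) k -> set0 k] by exact: w0.
  by apply: filterS => k /= h; apply: contrapT => /h.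
have [U [UU sU]] := ultraFilterLemma PF.
have UV : U (u @^-1` V).
  suff /(ul U UU) : \oo `<=` U by exact.
  by apply: subset_trans sU; exact: (@cvg_within _ \oo).
have UnV : U (~` (u @^-1` V)) by apply: sU; exact: withinT.
by have [k []] := filter_ex (filterI UV UnV).
Qed.

Section RealLimits.
Variables (R : realType) (T : topologicalType) (F : set_system T).
Context {FF : ProperFilter F}.

Lemma rcvg_unique (u : T -> R) (l l' : R) : u @ F --> l -> u @ F --> l' -> l = l'.
Proof. by move=> ul ul'; apply: (cvg_unique _ ul ul'); exact: Rhausdorff. Qed.

Lemma rcvg_sum (I : Type) (r : seq I) (P : pred I) (f : I -> T -> R) (l : I -> R) :
  (forall i, P i -> f i @ F --> l i) ->
  (fun k => \sum_(i <- r | P i) f i k) @ F --> \sum_(i <- r | P i) l i.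
Proof. by move=> fl; apply: cvg_big fl; exact: add_continuous. Qed.

Lemma rcvg_prod (I : Type) (r : seq I) (P : pred I) (f : I -> T -> R) (l : I -> R) :
  (forall i, P i -> f i @ F --> l i) ->
  (fun k => \prod_(i <- r | P i) f i k) @ F --> \prod_(i <- r | P i) l i.
Proof. by move=> fl; apply: cvg_big fl; exact: mul_continuous. Qed.

Lemma rcvg_ge (u : T -> R) (l a : R) :
  u @ F --> l -> F [set k | a <= u k] -> a <= l.
Proof. by move=> ul au; apply: (ler_cvg_to (f := fun=> a) (cvg_cst _) ul au). Qed.

Lemma rcvg_le (u : T -> R) (l a : R) :
  u @ F --> l -> F [set k | u k <= a] -> l <= a.
Proof. by move=> ul au; apply: (ler_cvg_to (g := fun=> a) ul (cvg_cst _) au). Qed.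

Lemma rcvg_eq (u : T -> R) (l a : R) :
  u @ F --> l -> F [set k | u k = a] -> l = a.
Proof.
move=> ul au; apply/eqP; rewrite eq_le; apply/andP; split.
  by apply: rcvg_le ul _; apply: filterS au => k /= ->.
by apply: rcvg_ge ul _; apply: filterS au => k /= ->.
Qed.

Lemma rcvg_near (u v : T -> R) (l : R) :
  F [set k | u k = v k] -> u @ F --> l -> v @ F --> l.
Proof. by move=> uv; apply: cvg_trans; exact: near_eq_cvg. Qed.

Definition mxcvg (m n : nat) (A_ : T -> 'M[R]_(m, n)) (A : 'M[R]_(m, n)) : Prop :=
  forall i j, (fun k => A_ k i j) @ F --> A i j.

Lemma mxcvg_mul (m n p : nat) (A_ : T -> 'M[R]_(m, n)) A (B_ : T -> 'M[R]_(n, p)) B :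
  mxcvg A_ A -> mxcvg B_ B -> mxcvg (fun k => A_ k *m B_ k) (A *m B).
Proof.
move=> AA BB i j; rewrite mxE; under eq_fun do rewrite mxE.
by apply: rcvg_sum => l _; apply: cvgM.
Qed.

Lemma mxcvg_tr (m n : nat) (A_ : T -> 'M[R]_(m, n)) A :
  mxcvg A_ A -> mxcvg (fun k => (A_ k)^T) A^T.
Proof. by move=> AA i j; rewrite mxE; under eq_fun do rewrite mxE; exact: AA. Qed.

Lemma mxcvg_cst (m n : nat) (A : 'M[R]_(m, n)) : mxcvg (fun=> A) A.
Proof. by move=> i j; exact: cvg_cst. Qed.

Lemma mxcvg_diag (n : nat) (A_ : T -> 'rV[R]_n) A :
  mxcvg A_ A -> mxcvg (fun k => diag_mx (A_ k)) (diag_mx A).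
Proof.
move=> AA i j; rewrite mxE; under eq_fun do rewrite mxE.
case: (i == j); first by rewrite mulr1n; exact: AA.
by rewrite mulr0n; exact: cvg_cst.
Qed.

Lemma mxcvg_trace (n : nat) (A_ : T -> 'M[R]_n) A :
  mxcvg A_ A -> (fun k => \tr (A_ k)) @ F --> \tr A.
Proof. by move=> AA; apply: rcvg_sum => i _; exact: AA. Qed.

Lemma mxcvg_unique (m n : nat) (A_ : T -> 'M[R]_(m, n)) A B :
  mxcvg A_ A -> mxcvg A_ B -> A = B.
Proof. by move=> AA AB; apply/matrixP => i j; exact: rcvg_unique (AA i j) (AB i j). Qed.

Lemma mxcvg_near (m n : nat) (A_ B_ : T -> 'M[R]_(m, n)) A :
  F [set k | A_ k = B_ k] -> mxcvg A_ A -> mxcvg B_ A.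
Proof.
move=> AB AA i j; apply: rcvg_near (AA i j).
by apply: filterS AB => k /= ->.
Qed.
End RealLimits.

Lemma mxcvg_ultra_bounded (R : realType) (U : set_system nat) {FU : UltraFilter U}
    (m n : nat) (A_ : nat -> 'M[R]_(m, n)) (M : R) :
  (forall i j, U [set k | `|A_ k i j| <= M]) -> exists A, mxcvg U A_ A.
Proof.
move=> AM; have h i j : exists l : R, (fun k => A_ k i j) @ U --> l.
  exact: (cvg_ultra_bounded (AM i j)).
exists (\matrix_(i, j) proj1_sig (cid (h i j))) => i j.
by rewrite mxE; exact: (proj2_sig (cid (h i j))).
Qed.

(** * Spectral theorem for real symmetric matrices *)

Section Spectral.
Variable R : realType.
Implicit Types m n : nat.

Definition qform n (A : 'M[R]_n) (v : 'cV[R]_n) : R := (v^T *m A *m v) 0 0.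

Lemma sum_sqr_cV n (v : 'cV[R]_n) : (v^T *m v) 0 0 = \sum_i v i 0 ^+ 2.
Proof. by rewrite mxE; apply: eq_bigr => i _; rewrite mxE expr2. Qed.

Lemma sum_sqr_cV_eq0 n (v : 'cV[R]_n) : (v^T *m v) 0 0 = 0 -> v = 0.
Proof.
rewrite sum_sqr_cV => /eqP; rewrite psumr_eq0 => [/allP h|i _]; last exact: sqr_ge0.
apply/matrixP => i j; rewrite ord1 mxE; apply/eqP.
by have := h i; rewrite mem_index_enum => /(_ isT); rewrite sqrf_eq0.
Qed.

Lemma cV_sqr_gt0 n (v : 'cV[R]_n) : v != 0 -> 0 < (v^T *m v) 0 0.
Proof.
move=> v0; rewrite lt_def; apply/andP; split.
  by apply: contra_neq v0; exact: sum_sqr_cV_eq0.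
by rewrite sum_sqr_cV; apply: sumr_ge0 => i _; exact: sqr_ge0.
Qed.

Lemma cV_entry_le1 n (v : 'cV[R]_n) i : (v^T *m v) 0 0 = 1 -> `|v i 0| <= 1.
Proof.
rewrite sum_sqr_cV (bigD1 i) //= => h.
rewrite -(@ler_pXn2r _ 2) ?nnegrE // expr1n -normrX ger0_norm ?sqr_ge0 // -h lerDl.
by apply: sumr_ge0 => j _; exact: sqr_ge0.
Qed.

Lemma trmx11 (A : 'M[R]_1) : A^T = A.
Proof. by apply/matrixP => i j; rewrite mxE !ord1. Qed.

Lemma bilin_sym n (A : 'M[R]_n) (v w : 'cV[R]_n) : A^T = A ->
  (v^T *m A *m w) 0 0 = (w^T *m A *m v) 0 0.
Proof.
by move=> sA; rewrite -[in LHS](trmx11 (_ *m w)) !trmx_mul trmxK sA mulmxA.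
Qed.

Lemma qformD n (A : 'M[R]_n) (v w : 'cV[R]_n) t : A^T = A ->
  qform A (v + t *: w) =
  qform A v + 2 * t * (w^T *m A *m v) 0 0 + t ^+ 2 * qform A w.
Proof.
move=> sA; have -> : qform A (v + t *: w) =
    qform A v + t * (v^T *m A *m w) 0 0 + (t * (w^T *m A *m v) 0 0 +
    t * (t * qform A w)).
  rewrite /qform; have -> : (v + t *: w)^T = v^T + t *: w^T.
    by apply/matrixP => i j; rewrite !mxE.
  rewrite !mulmxDl !mulmxDr -!scalemxAl -!scalemxAr.
  by rewrite ![(_ + _ : 'M[R]_1) 0 0]mxE ![(_ *: _ : 'M[R]_1) 0 0]mxE.
rewrite (bilin_sym v w sA); ring.
Qed.

Lemma qformZ n (A : 'M[R]_n) (v : 'cV[R]_n) t : qform A (t *: v) = t ^+ 2 * qform A v.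
Proof.
rewrite /qform; have -> : (t *: v)^T = t *: v^T.
  by apply/matrixP => i j; rewrite !mxE.
by rewrite -!scalemxAl -!scalemxAr scalerA -expr2 [LHS]mxE.
Qed.

(* The maximum of the Rayleigh quotient is attained at an eigenvector. *)
Lemma sym_eigenvector n (A : 'M[R]_n.+1) : A^T = A ->
  exists (v : 'cV[R]_n.+1) (l : R), (v^T *m v) 0 0 = 1 /\ A *m v = l *: v.
Proof.
move=> sA.
pose E := [set qform A v | v in [set v : 'cV[R]_n.+1 | (v^T *m v) 0 0 = 1]].
have E0 : E !=set0.
  exists (qform A (delta_mx 0 0)), (delta_mx 0 0) => //=.
  by rewrite trmx_delta mul_delta_mx mxE !eqxx.
have Eub : has_ubound E.
  exists (\sum_i \sum_j `|A i j|) => _ [v v1 <-].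
  rewrite /qform mxE (le_trans (ler_norm _)) // (le_trans (ler_norm_sum _ _ _)) //.
  rewrite exchange_big /=; apply: ler_sum => j _.
  rewrite mxE normrM -[leRHS]mulr1 ler_pM ?(cV_entry_le1 _ v1) //.
  apply: (le_trans (ler_norm_sum _ _ _)); apply: ler_sum => i _.
  by rewrite mxE normrM -[leRHS]mul1r ler_pM ?(cV_entry_le1 _ v1).
have hE : has_sup E by [].
pose l := sup E.
have hv k : exists v : 'cV[R]_n.+1, (v^T *m v) 0 0 = 1 /\ l - k.+1%:R^-1 < qform A v.
  have k0 : 0 < k.+1%:R^-1 :> R by rewrite invr_gt0.
  by have [_ [v v1 <-] vl] := sup_adherent k0 hE; exists v.
pose v_ k := proj1_sig (cid (hv k)).
have v1 k : ((v_ k)^T *m v_ k) 0 0 = 1 := proj1 (proj2_sig (cid (hv k))).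
have vl k : l - k.+1%:R^-1 < qform A (v_ k) := proj2 (proj2_sig (cid (hv k))).
(* The entries of unit vectors are bounded by 1, so a maximising sequence has a limit along [U],
   which attains the supremum. *)
have [U [UU sU]] := ultraFilterLemma (eventually_filter : ProperFilter \oo).
have [v vv] : exists v, mxcvg U v_ v.
  apply: (@mxcvg_ultra_bounded _ _ _ _ _ _ 1) => i j.
  by apply: filterS filterT => k _ /=; rewrite ord1; exact: cV_entry_le1.
have v11 : (v^T *m v) 0 0 = 1.
  have c1 : mxcvg U (fun k => (v_ k)^T *m v_ k) (v^T *m v).
    by apply: (mxcvg_mul _ vv); exact: (mxcvg_tr vv).
  apply: (rcvg_eq (c1 0 0)).
  by apply: filterS filterT => k _ /=.
have qv : l <= qform A v.
  have c1 : mxcvg U (fun k => (v_ k)^T *m A *m v_ k) (v^T *m A *m v).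
    by apply: (mxcvg_mul _ vv); apply: mxcvg_mul; [exact: (mxcvg_tr vv)|exact: mxcvg_cst].
  have c2 : (fun k => l - k.+1%:R^-1) @ U --> l - 0.
    apply: cvgB; first exact: cvg_cst.
    by move=> W Wn; apply: sU; exact: cvg_harmonic Wn.
  rewrite -[l]subr0; apply: (ler_cvg_to c2 (c1 0 0)).
  by apply: filterS filterT => k _ /=; exact: ltW.
have qmax w : qform A w <= l * (w^T *m w) 0 0.
  have [->|w0] := eqVneq w 0.
    by rewrite /qform !mulmx0 mxE mulr0.
  have s0 := cV_sqr_gt0 w0; set s := (_ *m _) 0 0 in s0 *.
  pose c := (Num.sqrt s)^-1.
  have c2 : c ^+ 2 = s^-1 by rewrite exprVn sqr_sqrtr // ltW.
  have : E (qform A (c *: w)) -> qform A (c *: w) <= l by exact: ub_le_sup.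
  rewrite qformZ c2 [_ * qform _ _]mulrC ler_pdivrMr //; apply; exists (c *: w).
    have := qformZ 1%:M w c; rewrite /qform !mulmx1 c2 => /= ->.
    by rewrite mulVf // gt_eqF.
  by rewrite qformZ c2 mulrC.
exists v, l; split => //.
(* Moving from the maximiser [v] in the direction of the residual [w] changes the form by a
   first-order term proportional to the squared norm of [w], which must therefore vanish. *)
pose w := A *m v - l *: v; suff : w = 0 by move/eqP; rewrite subr_eq0 => /eqP.
apply: sum_sqr_cV_eq0.
have e1 : (w^T *m w) 0 0 = (w^T *m A *m v) 0 0 - l * (w^T *m v) 0 0.
  have mB (B C : 'M[R]_1) : (B - l *: C) 0 0 = B 0 0 - l * C 0 0 by rewrite !mxE.
  by rewrite {2}/w mulmxBr -scalemxAr mulmxA mB.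
set a := (w^T *m w) 0 0 in e1 *.
have h t : 2 * t * a + t ^+ 2 * (qform A w - l * a) <= 0.
  have := qmax (v + t *: w); rewrite qformD //.
  have -> : ((v + t *: w)^T *m (v + t *: w)) 0 0 =
     qform 1%:M (v + t *: w) by rewrite /qform mulmx1.
  rewrite qformD ?trmx1 // /qform !mulmx1 v11 -/a e1 => h.
  rewrite /qform in qv; nra.
have a0 : 0 <= a by rewrite /a sum_sqr_cV; apply: sumr_ge0 => i _; exact: sqr_ge0.
apply/eqP; rewrite eq_le a0 andbT leNgt; apply/negP => ap.
pose b := qform A w - l * a; rewrite -/b in h.
have b0 : 0 < `|b| + 1 by rewrite ltr_wpDl.
(* This step is short enough for the linear term to dominate the quadratic one, whatever the sign of
   [b]. *)
have := h (a / (`|b| + 1)); apply/negP; rewrite -ltNge.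
have -> : 2 * (a / (`|b| + 1)) * a + (a / (`|b| + 1)) ^+ 2 * b =
  (a / (`|b| + 1)) ^+ 2 * (2 * (`|b| + 1) + b) by field; rewrite gt_eqF.
rewrite mulr_gt0 // ?exprn_gt0 ?divr_gt0 //.
by have := ler_norm (- b); rewrite normrN; lra.
Qed.
End Spectral.

Section Spectral.
Variable R : realType.
Implicit Types m n : nat.

(** The reflection in the hyperplane orthogonal to [v - e] exchanges the unit vectors [v] and
    [e]. *)
Lemma householder n (v : 'cV[R]_n.+1) : (v^T *m v) 0 0 = 1 ->
  exists Q : 'M[R]_n.+1, [/\ Q^T = Q, Q *m Q = 1%:M & Q *m v = delta_mx 0 0].
Proof.
move=> v1; pose e : 'cV[R]_n.+1 := delta_mx 0 0.
have [ve|ve] := eqVneq v e.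
  by exists 1%:M; rewrite trmx1 mulmx1 mul1mx ve.
pose w := v - e; have w0 : w != 0 by rewrite subr_eq0.
have ws := cV_sqr_gt0 w0; set s := (_ *m _) 0 0 in ws.
have wws : w^T *m w = s%:M by rewrite [LHS]mx11_scalar.
have ee : (e^T *m e) 0 0 = 1 by rewrite trmx_delta mul_delta_mx mxE !eqxx.
have wv : (w^T *m v) 0 0 = s / 2.
  have mB (B C : 'M[R]_1) : (B - C) 0 0 = B 0 0 - C 0 0 by rewrite !mxE.
  have wT : w^T = v^T - e^T by apply/matrixP => i j; rewrite !mxE.
  have sE : s = 2 * (w^T *m v) 0 0.
    rewrite /s {2}/w mulmxBr mB wT !mulmxBl !mB v1 ee.
    have -> : (v^T *m e) 0 0 = (e^T *m v) 0 0.
      by rewrite -[in RHS](trmx11 (_ *m v)) trmx_mul trmxK.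
    ring.
  by rewrite sE; field.
exists (1%:M - (2 / s) *: (w *m w^T)); split.
- by apply/matrixP => i j; rewrite !mxE !big_ord1 !mxE eq_sym; ring.
- rewrite mulmxBl mul1mx mulmxBr mulmx1 -scalemxAl -!scalemxAr scalerA.
  rewrite mulmxA -(mulmxA w) wws mul_mx_scalar -scalemxAl scalerA.
  have -> : 2 / s * (2 / s) * s = 2 / s + 2 / s by field; rewrite gt_eqF.
  by rewrite scalerDl opprB addrK subrK.
- rewrite mulmxBl mul1mx -scalemxAl -mulmxA [w^T *m v]mx11_scalar wv.
  rewrite mul_mx_scalar scalerA; have -> : 2 / s * (s / 2) = 1.
    by field; rewrite gt_eqF.
  by rewrite scale1r /w opprB addrC subrK.
Qed.

(** Deflation: conjugating by the reflection that sends an eigenvector to the first basis vector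
    clears the first column off the diagonal, and by symmetry the first row; the induction
    hypothesis diagonalises the remaining block. *)
Theorem sym_spectral n (A : 'M[R]_n) : A^T = A ->
  exists (V : 'M[R]_n) (l : 'rV[R]_n), V^T *m V = 1%:M /\ A = V *m diag_mx l *m V^T.
Proof.
elim: n A => [|n IH] A sA.
  by exists 0, 0; split; apply/matrixP => -[].
have [v [l [v1 Av]]] := sym_eigenvector sA.
have [Q [QT QQ Qv]] := householder v1.
pose B : 'M[R]_(1 + n) := Q *m A *m Q.
have BT : B^T = B by rewrite /B !trmx_mul QT sA mulmxA.
have Qe : Q *m delta_mx 0 0 = v by rewrite -Qv mulmxA QQ mul1mx.
have Be : Q *m A *m Q *m delta_mx 0 0 = l *: delta_mx 0 0 :> 'cV[R]_n.+1.
  by rewrite -mulmxA Qe -mulmxA Av -scalemxAr Qv.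
have B0 (i j : 'I_(1 + n)) : j = 0 :> nat -> B i j = l * (i == 0 :> nat)%:R.
  move=> j0; have -> : j = ord0 by exact: val_inj.
  by have /matrixP/(_ i 0) := Be; rewrite -colE mxE => ->; rewrite !mxE eqxx andbT.
have ulB : ulsubmx B = l%:M.
  by apply/matrixP => i j; rewrite !ord1 mxE mxE B0 // mxE mulr1.
have dlB : dlsubmx B = 0.
  by apply/matrixP => i j; rewrite !ord1 mxE mxE B0 // mxE mulr0.
have urB : ursubmx B = 0 by rewrite -[B]BT -trmx_dlsub dlB trmx0.
have [V [k [V1 dV]]] : exists (V : 'M[R]_n) (k : 'rV[R]_n),
    V^T *m V = 1%:M /\ drsubmx B = V *m diag_mx k *m V^T.
  by apply: IH; rewrite trmx_drsub BT.
pose W : 'M[R]_(1 + n) := block_mx 1%:M 0 0 V.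
have WW : W^T *m W = 1%:M.
  rewrite /W tr_block_mx mulmx_block !trmx0 trmx1.
  by rewrite !mulmx0 !mul0mx !mul1mx V1 !addr0 add0r -scalar_mx_block.
have BW : B = W *m diag_mx (row_mx l%:M k) *m W^T.
  rewrite -[LHS]submxK ulB dlB urB dV diag_mx_row /W tr_block_mx !mulmx_block.
  rewrite !trmx0 trmx1 !mulmx0 !mul0mx !mul1mx !mulmx1 !addr0 !add0r mul0mx.
  by congr block_mx; apply/matrixP => i j; rewrite !ord1 !mxE.
exists (Q *m W), (row_mx l%:M k); split.
  by rewrite trmx_mul QT mulmxA -(mulmxA _ Q Q) QQ mulmx1.
have -> : A = Q *m B *m Q.
  by rewrite /B !mulmxA QQ mul1mx -mulmxA QQ mulmx1.
by rewrite trmx_mul QT BW !mulmxA.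
Qed.

(** * Diagonalisation and real powers of positive definite matrices *)

Definition pdiag n (A : 'M[R]_n) (V : 'M[R]_n) (l : 'rV[R]_n) : Prop :=
  [/\ V^T *m V = 1%:M, A = V *m diag_mx l *m V^T & forall i, 0 < l 0 i].

Lemma qform_diag n (V : 'M[R]_n) (l : 'rV[R]_n) i : V^T *m V = 1%:M ->
  qform (V *m diag_mx l *m V^T) (col i V) = l 0 i.
Proof.
move=> V1; have cV : V^T *m col i V = delta_mx i 0 by rewrite colE mulmxA V1 mul1mx.
rewrite /qform !mulmxA -[_^T *m V]trmxK trmx_mul trmxK cV -(mulmxA _ V^T) cV.
by rewrite trmx_delta -rowE -colE !mxE eqxx mulr1n.
Qed.

Lemma pdmx_pdiag n (A : 'M[R]_n) : pdmx A -> exists V l, pdiag A V l.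
Proof.
move=> [sA pA]; have [V [l [V1 AE]]] := sym_spectral sA; exists V, l; split => // i.
rewrite -(qform_diag l i V1) -AE; apply: pA; apply/eqP => c0.
have /matrixP/(_ i i) := V1; rewrite !mxE eqxx big1 => [/esym/eqP|j _].
  by rewrite oner_eq0.
by have /matrixP/(_ j 0) := c0; rewrite !mxE => ->; rewrite mulr0.
Qed.

Lemma orthmx_r n (V : 'M[R]_n) : V^T *m V = 1%:M -> V *m V^T = 1%:M.
Proof. exact: mulmx1C. Qed.

(** A nonzero entry [W i j] forces [a 0 i = b 0 j], so [W] also intertwines any function of the
    eigenvalues. *)
Lemma diag_intertwine n (W : 'M[R]_n) (a b : 'rV[R]_n) (f : R -> R) :
  diag_mx a *m W = W *m diag_mx b ->
  diag_mx (\row_i f (a 0 i)) *m W = W *m diag_mx (\row_i f (b 0 i)).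
Proof.
move=> h; apply/matrixP => i j; have /matrixP/(_ i j) := h.
rewrite !mul_diag_mx !mul_mx_diag !mxE.
have [->|W0] := eqVneq (W i j) 0; first by rewrite !mulr0 !mul0r.
by rewrite mulrC => /(mulfI W0) ->; rewrite mulrC.
Qed.

Lemma orth_conj_eq n (V W : 'M[R]_n) (a b : 'M[R]_n) :
  V^T *m V = 1%:M -> W^T *m W = 1%:M ->
  (V *m a *m V^T = W *m b *m W^T) <-> (a *m (V^T *m W) = V^T *m W *m b).
Proof.
move=> V1 W1; split => h.
  have := congr1 (fun M => V^T *m M *m W) h.
  by rewrite !mulmxA V1 mul1mx -(mulmxA _ W^T W) W1 mulmx1 -mulmxA => ->.
have := congr1 (fun M => V *m M *m W^T) h.
by rewrite !mulmxA (orthmx_r V1) mul1mx -(mulmxA _ W W^T) (orthmx_r W1) mulmx1.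
Qed.

Lemma pdiag_orth_diag n (A V : 'M[R]_n) l : pdiag A V l -> orth_diag A (V, l).
Proof. by move=> [V1 AE l0]; split => //; split => // i; exact: ltW. Qed.

(** The change of basis between two diagonalisations of [A] intertwines their eigenvalues, hence
    also the powers; the choice made by [cid] is thus immaterial. *)
Lemma mxpowrE n (A V : 'M[R]_n) l r : orth_diag A (V, l) ->
  mxpowr A r = V *m diag_mx (\row_i powR (l 0 i) r) *m V^T.
Proof.
move=> h; rewrite /mxpowr; case: pselect => [h'|/(_ (ex_intro _ _ h))//].
case: (cid h') => -[W k] /= [/= W1 [AE _]]; case: h => /= V1 [AE' _].
apply/(orth_conj_eq _ _ W1 V1); apply: (diag_intertwine (fun x => powR x r)).
by apply/(orth_conj_eq _ _ W1 V1); rewrite -AE.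
Qed.

Lemma pdiag_det n (A V : 'M[R]_n) l : pdiag A V l ->
  \det A = \prod_i l 0 i.
Proof.
move=> [V1 -> _]; rewrite !det_mulmx det_diag det_tr mulrC mulrA.
by have := congr1 determinant V1; rewrite det_mulmx det_tr det1 => ->; rewrite mul1r.
Qed.

Lemma pdiag_tr n (A V : 'M[R]_n) l : pdiag A V l ->
  forall r, \tr (mxpowr A r) = \sum_i powR (l 0 i) r.
Proof.
move=> h r; rewrite (mxpowrE r (pdiag_orth_diag h)); case: h => V1 _ _.
rewrite mxtrace_mulC mulmxA V1 mul1mx mxtrace_diag.
by apply: eq_bigr => i _; rewrite mxE.
Qed.
End Spectral.

(** * Kiefer's criterion on positive definite matrices *)

Section Kiefer.
Variable R : realType.
Implicit Types (n : nat) (q x a b : R).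

(** On positive reals this is a primitive of [powR a (q - 1)] for every [q]; the division by [q]
    makes it increasing also for negative [q]. *)
Definition kief q a : R := if q == 0 then ln a else powR a q / q.

Lemma powR_expR a q : 0 < a -> powR a q = expR (q * ln a).
Proof. by move=> a0; rewrite /powR gt_eqF. Qed.

(** This is the tangent inequality at 1 for [t ^ q / q], with [t = expR x]. For negative [q] it is
    enough to apply [1 + u < e^u] at [q * x] and at [x]. *)
Lemma expR_tangent q x : q < 1 -> q != 0 -> x != 0 ->
  expR (q * x) / q < q^-1 + (expR x - 1).
Proof.
move=> q1 q0 x0.
have [qlt|qgt|/eqP] := ltgtP q 0; last by rewrite (negbTE q0).
  have h1 := expR_gt1Dx (mulf_neq0 q0 x0); have h2 := expR_gt1Dx x0.
  have qV : q^-1 < 0 by rewrite invr_lt0.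
  have e1 : q^-1 * q = 1 by rewrite mulVf.
  rewrite mulrC; move: (expR (q * x)) (expR x) h1 h2 => u v h1 h2; nra.
(* [1 + u < e^u] is applied to [e^x / e^(qx)] and to [1 / e^(qx)] *)
have h1 : 1 + (1 - q) * x < expR ((1 - q) * x).
  by apply: expR_gt1Dx; rewrite mulf_neq0 // gt_eqF // subr_gt0.
have h2 : 1 + (- q) * x < expR ((- q) * x).
  by apply: expR_gt1Dx; rewrite mulf_neq0 // oppr_eq0.
have u0 := expR_gt0 (q * x).
have e1 : expR x = expR (q * x) * expR ((1 - q) * x).
  by rewrite -expRD -mulrDl subrKC mul1r.
have e2 : 1 = expR (q * x) * expR ((- q) * x).
  by rewrite -expRD -mulrDl subrr mul0r expR0.
have q1' : 0 < 1 - q by rewrite subr_gt0.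
suff : expR (q * x) < 1 + q * (expR x - 1).
  have -> : q^-1 + (expR x - 1) = (1 + q * (expR x - 1)) / q by field.
  by rewrite ltr_pM2r ?invr_gt0.
have -> : 1 + q * (expR x - 1) = q * expR x + (1 - q) * 1 by ring.
rewrite [in X in _ < _ + _ * X]e2 e1.
move: (expR (q * x)) (expR ((1 - q) * x)) (expR ((- q) * x)) u0 h1 h2 => u v w u0 h1 h2.
(* With weights [q] and [1 - q] the terms linear in [x] cancel, and the left side is just [u]. *)
have : u * (q * (1 + (1 - q) * x) + (1 - q) * (1 + (- q) * x)) <
       u * (q * v + (1 - q) * w).
  by rewrite ltr_pM2l // ltrD // ltr_pM2l.
have -> : q * (1 + (1 - q) * x) + (1 - q) * (1 + - q * x) = 1 by ring.
rewrite mulr1; lra.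
Qed.

(** Factoring out [powR a q] reduces the claim to the ratio [b / a = expR x], where [x] is nonzero
    because [ln] is injective. *)
Lemma kief_tangent_lt q a b : q < 1 -> 0 < a -> 0 < b -> a != b ->
  kief q b < kief q a + powR a (q - 1) * (b - a).
Proof.
move=> q1 a0 b0 ab; pose x := ln b - ln a.
have x0 : x != 0.
  by rewrite subr_eq0; apply: contra ab => /eqP /ln_inj ->.
have bE : b = a * expR x by rewrite /x expRD expRN !lnK // mulrCA divff ?mulr1 // gt_eqF.
have pa : powR a (q - 1) * (b - a) = powR a q * (expR x - 1).
  rewrite bE -[X in _ * (_ - X)]mulr1 -mulrBr mulrA; congr (_ * _).
  rewrite !powR_expR // mulrBl mul1r expRD expRN lnK // divfK // gt_eqF //.
rewrite pa /kief; case: eqP => [->|/eqP q0].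
  have := expR_gt1Dx x0; rewrite powRr0 mul1r /x; lra.
have -> : powR b q = powR a q * expR (q * x).
  by rewrite !powR_expR // -expRD /x -mulrDr addrC subrK.
by rewrite -mulrA -mulrDr ltr_pM2l ?powR_gt0 // expR_tangent.
Qed.

Lemma kief_tangent q a b : q < 1 -> 0 < a -> 0 < b ->
  kief q b <= kief q a + powR a (q - 1) * (b - a).
Proof.
move=> q1 a0 b0; have [->|ab] := eqVneq a b; first by rewrite subrr mulr0 addr0.
by rewrite ltW // kief_tangent_lt.
Qed.

Definition Fq n q (A : 'M[R]_n) : R :=
  if q == 0 then ln (\det A) else \tr (mxpowr A q) / q.

Lemma FqE n q (A V : 'M[R]_n) l : pdiag A V l -> Fq q A = \sum_i kief q (l 0 i).
Proof.
move=> h; rewrite /Fq /kief; case: eqP => [_|_].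
  rewrite (pdiag_det h) -[RHS]expRK expR_sum; congr (ln _).
  by apply: eq_bigr => i _; rewrite lnK // posrE; case: h.
by rewrite (pdiag_tr h) mulr_suml.
Qed.

Lemma tr_diag_conj n (V W : 'M[R]_n) (a b : 'rV[R]_n) :
  \tr ((V *m diag_mx a *m V^T) *m (W *m diag_mx b *m W^T)) =
  \sum_i \sum_j a 0 i * b 0 j * (V^T *m W) i j ^+ 2.
Proof.
have -> : \tr ((V *m diag_mx a *m V^T) *m (W *m diag_mx b *m W^T)) =
    \tr ((diag_mx a *m (V^T *m W)) *m (diag_mx b *m (V^T *m W)^T)).
  by rewrite -!mulmxA mxtrace_mulC !mulmxA trmx_mul trmxK !mulmxA.
rewrite /mxtrace; apply: eq_bigr => i _; rewrite mxE; apply: eq_bigr => j _.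
by rewrite !mul_diag_mx !mxE; ring.
Qed.

(** The squared entries of the orthogonal matrix [V^T *m W] have row and column sums 1. Inserting
    them as weights turns the matrix gap into a weighted sum of scalar gaps, as in Klein's
    inequality. *)
Lemma Fq_gap n q (A B V W : 'M[R]_n) (a b : 'rV[R]_n) :
  pdiag A V a -> pdiag B W b ->
  Fq q A + \tr (mxpowr A (q - 1) *m (B - A)) - Fq q B =
  \sum_i \sum_j (V^T *m W) i j ^+ 2 *
    (kief q (a 0 i) + powR (a 0 i) (q - 1) * (b 0 j - a 0 i) - kief q (b 0 j)).
Proof.
move=> hA hB; rewrite (FqE q hA) (FqE q hB) (mxpowrE _ (pdiag_orth_diag hA)).
case: hA hB => V1 AE a0 [W1 BE b0].
rewrite mulmxBr linearB /= BE AE !tr_diag_conj V1.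
set M := V^T *m W.
have MM : M *m M^T = 1%:M.
  by rewrite /M trmx_mul trmxK mulmxA -(mulmxA _ W) (orthmx_r W1) mulmx1.
have MM' : M^T *m M = 1%:M := mulmx1C MM.
clearbody M.
have rowM i : \sum_j M i j ^+ 2 = 1.
  have /matrixP/(_ i i) := MM; rewrite !mxE eqxx; apply: etrans.
  by apply: eq_bigr => j _; rewrite mxE expr2.
have colM j : \sum_i M i j ^+ 2 = 1.
  have /matrixP/(_ j j) := MM'; rewrite !mxE eqxx; apply: etrans.
  by apply: eq_bigr => i _; rewrite mxE expr2.
have e1 : \sum_i \sum_j M i j ^+ 2 * kief q (b 0 j) = \sum_j kief q (b 0 j).
  by rewrite exchange_big; apply: eq_bigr => j _; rewrite -mulr_suml colM mul1r.
have e2 f : \sum_i \sum_j M i j ^+ 2 * f i = \sum_i f i.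
  by apply: eq_bigr => i _; rewrite -mulr_suml rowM mul1r.
have e3 : \sum_i \sum_j (\row_i0 powR (a 0 i0) (q - 1)) 0 i * a 0 j *
    (1%:M : 'M[R]_n) i j ^+ 2 = \sum_i powR (a 0 i) (q - 1) * a 0 i.
  apply: eq_bigr => i _; rewrite (bigD1 i) //= big1 => [|j ji].
    by rewrite !mxE eqxx expr1n mulr1 addr0.
  by rewrite !mxE eq_sym (negbTE ji) expr0n mulr0.
rewrite e3 -e1 -[X in X + _ - _]e2 -[X in _ + (_ - X) - _]e2.
rewrite -!sumrB -big_split -sumrB; apply: eq_bigr => i _.
rewrite -!sumrB -big_split -sumrB; apply: eq_bigr => j _ /=.
by rewrite !mxE; ring.
Qed.

Lemma Fq_gap_ge0 q a b (m : R) : q < 1 -> 0 < a -> 0 < b ->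
  0 <= m ^+ 2 * (kief q a + powR a (q - 1) * (b - a) - kief q b).
Proof. by move=> *; rewrite mulr_ge0 ?sqr_ge0 // subr_ge0 kief_tangent. Qed.

Lemma Fq_tangent n q (A B : 'M[R]_n) : q < 1 -> pdmx A -> pdmx B ->
  Fq q B <= Fq q A + \tr (mxpowr A (q - 1) *m (B - A)).
Proof.
move=> q1 /pdmx_pdiag [V [a hA]] /pdmx_pdiag [W [b hB]].
rewrite -subr_ge0 (Fq_gap q hA hB); case: hA hB => _ _ a0 [_ _ b0].
by do 2 (apply: sumr_ge0 => ? _); exact: Fq_gap_ge0.
Qed.

(** In the equality case every weighted scalar gap vanishes; by strictness [V^T *m W] then has
    entries only between equal eigenvalues, so it intertwines the two diagonals. *)
Lemma Fq_tangent_eq n q (A B : 'M[R]_n) : q < 1 -> pdmx A -> pdmx B ->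
  Fq q A + \tr (mxpowr A (q - 1) *m (B - A)) <= Fq q B -> A = B.
Proof.
move=> q1 /pdmx_pdiag [V [a hA]] /pdmx_pdiag [W [b hB]].
rewrite -subr_le0 (Fq_gap q hA hB) => le0.
case: hA hB => V1 -> a0 [W1 -> b0].
have g0 i j : (V^T *m W) i j ^+ 2 *
    (kief q (a 0 i) + powR (a 0 i) (q - 1) * (b 0 j - a 0 i) - kief q (b 0 j)) = 0.
  have s0 i' : 0 <= \sum_j (V^T *m W) i' j ^+ 2 *
    (kief q (a 0 i') + powR (a 0 i') (q - 1) * (b 0 j - a 0 i') - kief q (b 0 j)).
    by apply: sumr_ge0 => ? _; exact: Fq_gap_ge0.
  apply/eqP; rewrite eq_le Fq_gap_ge0 // andbT.
  apply: le_trans le0; rewrite [leRHS](bigD1 i) //=.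
  apply: (@le_trans _ _ (\sum_j (V^T *m W) i j ^+ 2 *
    (kief q (a 0 i) + powR (a 0 i) (q - 1) * (b 0 j - a 0 i) - kief q (b 0 j)))).
    by rewrite [leRHS](bigD1 j) //= lerDl; apply: sumr_ge0 => ? _; exact: Fq_gap_ge0.
  by rewrite lerDl; apply: sumr_ge0.
apply/(orth_conj_eq _ _ V1 W1); apply/matrixP => i j.
rewrite mul_diag_mx mul_mx_diag [LHS]mxE [RHS]mxE.
have [->|ab] := eqVneq (a 0 i) (b 0 j); first by rewrite mulrC.
have /eqP := g0 i j; rewrite mulf_eq0 sqrf_eq0 => /orP[/eqP->|].
  by rewrite mulr0 mul0r.
by rewrite gt_eqF // subr_gt0 kief_tangent_lt.
Qed.

Lemma pdmx_det_gt0 n (A : 'M[R]_n) : pdmx A -> 0 < \det A.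
Proof.
move=> /pdmx_pdiag [V [a h]]; rewrite (pdiag_det h).
by case: h => _ _ a0; apply: prodr_gt0.
Qed.

Lemma pdmx_unitmx n (A : 'M[R]_n) : pdmx A -> A \in unitmx.
Proof. by move=> /pdmx_det_gt0 h; rewrite unitmxE unitfE gt_eqF. Qed.

Lemma pdmx_tr_gt0 n q (A : 'M[R]_n) : (0 < n)%N -> pdmx A -> 0 < \tr (mxpowr A q).
Proof.
move=> n0 /pdmx_pdiag [V [a h]]; rewrite (pdiag_tr h); case: h => _ _ a0.
rewrite (bigD1 (Ordinal n0)) //= ltr_pwDl ?powR_gt0 //.
by apply: sumr_ge0 => i _; exact: powR_ge0.
Qed.

(** For negative [q] the outer power [q^-1] and the division by [q] in [Fq] both reverse the order,
    so the two comparisons agree for every [q]. *)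
Lemma phiq_le n q (A B : 'M[R]_n) : (0 < n)%N -> pdmx A -> pdmx B ->
  (phiq q A <= phiq q B) = (Fq q A <= Fq q B).
Proof.
move=> n0 pA pB; rewrite /phiq /Fq !pdmx_unitmx //=.
have n0' : 0 < n%:R^-1 :> R by rewrite invr_gt0 ltr0n.
case: eqP => [_|/eqP q0].
  by rewrite !powR_expR ?pdmx_det_gt0 // ler_expR ler_pM2l.
have tA := pdmx_tr_gt0 q n0 pA; have tB := pdmx_tr_gt0 q n0 pB.
rewrite !powR_expR ?mulr_gt0 // ler_expR ![_ / q]mulrC.
have [qlt|qgt|/eqP] := ltgtP q 0; last by rewrite (negbTE q0).
  by rewrite !ler_nM2l ?invr_lt0 // ler_ln ?posrE ?mulr_gt0 // ler_pM2r.
by rewrite !ler_pM2l ?invr_gt0 // ler_ln ?posrE ?mulr_gt0 // ler_pM2r.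
Qed.

(** * Continuity of matrix powers and of Kiefer's criterion along an ultrafilter *)

Section Continuity.
Variables (U : set_system nat).
Context {UU : UltraFilter U}.

Lemma powR_cvg (u : nat -> R) (l q : R) : 0 < l -> u @ U --> l ->
  (fun k => powR (u k) q) @ U --> powR l q.
Proof.
move=> l0 ul; have up : U [set k | 0 < u k].
  by have /= := ul _ (lt_nbhsr l0).
rewrite powR_expR //; apply: (@rcvg_near _ _ _ _ (fun k => expR (q * ln (u k)))).
  by apply: filterS up => k /= k0; rewrite powR_expR.
apply: (continuous_cvg _ (@continuous_expR R _)).
by apply: cvgM; [exact: cvg_cst|apply: continuous_cvg ul; exact: continuous_ln].
Qed.

(** Diagonalisations need not depend continuously on the matrix, but they are bounded: along [U]
    they converge to some diagonalisation of [A], and by [mxpowrE] any one computes the power. *)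
Lemma mxpowr_cvg n (A_ : nat -> 'M[R]_n) A q :
  (forall k, pdmx (A_ k)) -> pdmx A -> mxcvg U A_ A ->
  mxcvg U (fun k => mxpowr (A_ k) q) (mxpowr A q).
Proof.
move=> pA_ pA AA.
have hd k : exists Vl : 'M[R]_n * 'rV[R]_n, pdiag (A_ k) Vl.1 Vl.2.
  by have [V [l h]] := pdmx_pdiag (pA_ k); exists (V, l).
pose V_ k := (proj1_sig (cid (hd k))).1; pose l_ k := (proj1_sig (cid (hd k))).2.
have hk k : pdiag (A_ k) (V_ k) (l_ k) := proj2_sig (cid (hd k)).
have [V VV] : exists V, mxcvg U V_ V.
  apply: (@mxcvg_ultra_bounded _ _ _ _ _ _ 1) => i j.
  apply: filterS filterT => k _ /=; case: (hk k) => V1 _ _.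
  have -> : V_ k i j = col j (V_ k) i 0 by rewrite mxE.
  apply: cV_entry_le1; have /matrixP/(_ j j) := V1.
  rewrite ![(_ *m _) _ _]mxE [1%:M _ _]mxE eqxx; apply: etrans.
  by apply: eq_bigr => t _; rewrite !mxE.
(* The eigenvalues are positive, so each is at most the trace, which is below [\tr A + 1] along
   [U]. *)
have [l ll] : exists l, mxcvg U l_ l.
  apply: (@mxcvg_ultra_bounded _ _ _ _ _ _ (\tr A + 1)) => i j.
  have tt : U [set k | \tr (A_ k) < \tr A + 1].
    have tc : (fun k => \tr (A_ k)) @ U --> \tr A by exact: mxcvg_trace.
    by apply: (cvgr_lt _ tc); rewrite ltrDl.
  apply: filterS tt => k /= kt; rewrite ord1; case: (hk k) => V1 AE l0.
  rewrite gtr0_norm //; apply: le_trans (ltW kt).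
  rewrite AE mxtrace_mulC mulmxA V1 mul1mx mxtrace_diag (bigD1 j) //= lerDl.
  by apply: sumr_ge0 => t _; exact: ltW.
have V1 : V^T *m V = 1%:M.
  apply: (@mxcvg_unique _ _ U _ _ _ (fun k => (V_ k)^T *m V_ k)).
    by apply: mxcvg_mul => //; exact: mxcvg_tr.
  apply: (@mxcvg_near _ _ _ _ _ _ (fun=> 1%:M)); last exact: mxcvg_cst.
  by apply: filterS filterT => k _ /=; case: (hk k).
have cc (f_ : nat -> 'rV[R]_n) f : mxcvg U f_ f ->
    mxcvg U (fun k => V_ k *m diag_mx (f_ k) *m (V_ k)^T) (V *m diag_mx f *m V^T).
  move=> ff; apply: mxcvg_mul; last exact: mxcvg_tr.
  by apply: mxcvg_mul => //; exact: mxcvg_diag.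
have AE : A = V *m diag_mx l *m V^T.
  apply: (mxcvg_unique AA); apply: mxcvg_near (cc _ _ ll).
  by apply: filterS filterT => k _ /=; case: (hk k).
have l0 i : 0 < l 0 i.
  rewrite -(qform_diag l i V1) -AE; apply: (proj2 pA); apply/eqP => c0.
  have /matrixP/(_ i i) := V1; rewrite !mxE eqxx big1 => [/esym/eqP|j _].
    by rewrite oner_eq0.
  by have /matrixP/(_ j 0) := c0; rewrite !mxE => ->; rewrite mulr0.
have hA : pdiag A V l by [].
rewrite (mxpowrE q (pdiag_orth_diag hA)).
apply: (mxcvg_near _ (cc (fun k => \row_i powR (l_ k 0 i) q) _ _)).
  by apply: filterS filterT => k _ /=; rewrite (mxpowrE q (pdiag_orth_diag (hk k))).
move=> i j; rewrite mxE; under eq_fun do rewrite mxE.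
exact: powR_cvg.
Qed.

Lemma det_cvg n (A_ : nat -> 'M[R]_n) A :
  mxcvg U A_ A -> (fun k => \det (A_ k)) @ U --> \det A.
Proof.
move=> AA; apply: rcvg_sum => s _; apply: cvgM; first exact: cvg_cst.
by apply: rcvg_prod => i _; exact: AA.
Qed.

Lemma Fq_cvg n (A_ : nat -> 'M[R]_n) A q :
  (forall k, pdmx (A_ k)) -> pdmx A -> mxcvg U A_ A ->
  (fun k => Fq q (A_ k)) @ U --> Fq q A.
Proof.
move=> pA_ pA AA; rewrite /Fq; case: eqP => [_|_].
  apply: continuous_cvg (det_cvg AA).
  exact/continuous_ln/pdmx_det_gt0.
by apply: cvgM; [by apply: mxcvg_trace; apply: mxpowr_cvg|exact: cvg_cst].
Qed.

Lemma phiq_cvg n (A_ : nat -> 'M[R]_n) A q : (0 < n)%N ->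
  (forall k, pdmx (A_ k)) -> pdmx A -> mxcvg U A_ A ->
  (fun k => phiq q (A_ k)) @ U --> phiq q A.
Proof.
move=> n0 pA_ pA AA; rewrite /phiq pdmx_unitmx //=.
under eq_fun do rewrite pdmx_unitmx //=.
case: eqP => [_|_]; first by apply: powR_cvg; [exact: pdmx_det_gt0|exact: det_cvg].
apply: powR_cvg.
  by rewrite divr_gt0 ?ltr0n //; exact: pdmx_tr_gt0.
by apply: cvgM; [by apply: mxcvg_trace; apply: mxpowr_cvg|exact: cvg_cst].
Qed.
End Continuity.
End Kiefer.

(** * Riesz functionals *)

Section MomentFunctional.
Variables (R : realType) (n : nat).
Implicit Types (y z : mseq R n) (p f s : mpoly n R) (a b : multinom n).

(** The Riesz functional of [y], determined by sending the monomial of exponent [a] to [y a]. *)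
Definition Lf y p : R := \sum_(a <- msupp p) mcoeff a p * y a.

Lemma Lf_wE k y p : (msize p <= k)%N ->
  Lf y p = \sum_(a : bmultinom n k) mcoeff (bmnm a) p * y (bmnm a).
Proof.
move=> pk; pose I : subFinType _ := bmultinom n k.
rewrite /Lf (ssrcomplements.big_mksub I) //=; first last.
  by move=> a /msize_mdeg_lt /leq_trans; apply.
  by rewrite msupp_uniq.
by rewrite big_rmcond //= => a /memN_msupp_eq0 ->; rewrite mul0r.
Qed.

Lemma Lf_is_linear y : scalar (Lf y).
Proof.
move=> c p q; pose k := maxn (msize (c *: p + q)) (maxn (msize p) (msize q)).
rewrite !(@Lf_wE k) ?leq_max ?leqnn ?orbT // mulr_sumr -big_split /=.
by apply: eq_bigr => a _; rewrite mcoeffD mcoeffZ mulrDl mulrA.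
Qed.

HB.instance Definition _ y :=
  GRing.isLinear.Build R (mpoly n R) R *%R (Lf y) (Lf_is_linear y).

Lemma LfX y a : Lf y (mpolyX R a) = y a.
Proof. by rewrite /Lf msuppX big_seq1 mcoeffX eqxx mul1r. Qed.

Lemma LfZ y c p : Lf y (c *: p) = c * Lf y p. Proof. exact: linearZ. Qed.

(** Lets a functional such as [p] mapped to [Lf y (h * p)] be treated again as a moment sequence. *)
Lemma LfE (L : mpoly n R -> R) : scalar L ->
  forall p, L p = Lf (fun a => L (mpolyX R a)) p.
Proof.
move=> Llin p; have L0 : L 0 = 0.
  by have := Llin (-1) 0 0; rewrite scaler0 addr0 mulN1r addNr.
rewrite {1}[p]mpolyE /Lf; elim: (msupp p) => [|a r IH]; first by rewrite !big_nil.
by rewrite !big_cons Llin IH.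
Qed.

Lemma LfC y c : Lf y (mpolyC n c) = c * y mnm0.
Proof. by rewrite -[mpolyC n c]mulr1 mul_mpolyC LfZ -mpolyX0 LfX. Qed.

Lemma LfMX y f a :
  Lf y (f * mpolyX R a) = \sum_(b <- msupp f) mcoeff b f * y (mnm_add b a).
Proof.
rewrite {1}[f]mpolyE mulr_suml linear_sum /=; apply: eq_bigr => b _.
by rewrite -scalerAl -mpolyXD LfZ LfX.
Qed.

Definition vpoly k (v : 'cV[R]_(smon n k)) : mpoly n R :=
  \sum_i v i 0 *: mpolyX R (midx i).

Lemma midx_le k (i : 'I_(smon n k)) : (mdeg (midx i) <= k)%N.
Proof. by rewrite -ltnS; exact: bmdeg. Qed.

Lemma msize_vpoly k (v : 'cV[R]_(smon n k)) : (msize (vpoly v) <= k.+1)%N.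
Proof.
apply: leq_trans (mmeasure_sum _ _ _ _) _; apply/bigmax_leqP => i _.
by apply: leq_trans (msizeZ_le _ _) _; rewrite msizeX ltnS midx_le.
Qed.

Lemma sum_midx k (F : multinom n -> R) :
  \sum_(i < smon n k) F (midx i) = \sum_(a : bmultinom n k.+1) F (bmnm a).
Proof. by rewrite [RHS]big_enum_val. Qed.

Lemma vpolyP k s : (msize s <= k.+1)%N -> exists v : 'cV_(smon n k), s = vpoly v.
Proof.
move=> sk; exists (\col_i mcoeff (midx i) s); apply/mpolyP => a.
rewrite {1}(mpolywE sk) /vpoly !raddf_sum /=.
rewrite -(sum_midx k (fun b => mcoeff a (mcoeff b s *: mpolyX R b))).
by apply: eq_bigr => i _; rewrite mxE.
Qed.

Lemma qform_locmx k f y (v : 'cV_(smon n k)) :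
  qform (locmx k f y) v = Lf y (f * vpoly v ^+ 2).
Proof.
rewrite expr2 /vpoly mulr_sumr mulr_sumr linear_sum /qform mxE /=.
apply: eq_bigr => j _; rewrite mxE mulr_suml mulr_suml mulr_sumr linear_sum /=.
apply: eq_bigr => i _; rewrite !mxE -LfMX.
have -> : f * (v i 0 *: mpolyX R (midx i) * (v j 0 *: mpolyX R (midx j))) =
    (v i 0 * v j 0) *: (f * (mpolyX R (midx i) * mpolyX R (midx j))).
  by rewrite -scalerAl -!scalerAr scalerA.
by rewrite LfZ mpolyXD mulrAC.
Qed.

Lemma qform_momentmx k y (v : 'cV_(smon n k)) :
  qform (momentmx k y) v = Lf y (vpoly v ^+ 2).
Proof.
rewrite -[_ ^+ 2]mul1r -qform_locmx; congr qform; apply/matrixP => i j.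
by rewrite !mxE msupp1 big_seq1 mcoeff1 eqxx mul1r add0m.
Qed.

(** The quadratic form at a vector [v] is the functional evaluated at [f] times the square of the
    polynomial with coefficients [v]. *)
Lemma psdmx_locmx k f y :
  psdmx (locmx k f y) <-> forall s, (msize s <= k.+1)%N -> 0 <= Lf y (f * s ^+ 2).
Proof.
split=> [[_ h] s /vpolyP [v ->]|h]; first by rewrite -qform_locmx; exact: h.
split; last by move=> v; rewrite -/(qform _ _) qform_locmx; apply: h; exact: msize_vpoly.
by apply/matrixP => i j; rewrite !mxE; apply: eq_bigr => b _; rewrite [mnm_add (midx _) _]addmC.
Qed.

Lemma psdmx_momentmx k y :
  psdmx (momentmx k y) <-> forall s, (msize s <= k.+1)%N -> 0 <= Lf y (s ^+ 2).
Proof.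
split=> [[_ h] s /vpolyP [v ->]|h]; first by rewrite -qform_momentmx; exact: h.
split; last by move=> v; rewrite -/(qform _ _) qform_momentmx; apply: h; exact: msize_vpoly.
by apply/matrixP => i j; rewrite !mxE addmC.
Qed.

Definition ballpoly (r : R) : mpoly n R :=
  mpolyC n (r ^+ 2) - \sum_(i < n) mpolyX R (mnm1 i) ^+ 2.

Lemma mdeg_gt0_split a : (0 < mdeg a)%N -> exists i b, a = mnm_add (mnm1 i) b.
Proof.
rewrite lt0n mdeg_eq0 => a0.
have [i ai] : exists i, (0 < a i)%N.
  apply: contrapT => h; move/negP: a0; apply; apply/eqP/mnmP => i; rewrite mnm0E.
  by apply/eqP; rewrite -leqn0 leqNgt; apply/negP => ai; apply: h; exists i.
exists i, (mnm_sub a (mnm1 i)); rewrite addmC submK //.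
by apply/mnm_lepP => j; rewrite mnm1E; case: eqP => // <-.
Qed.

(** * Moment bounds from the ball constraint *)

Section BallBound.
Variables (k : nat) (y : mseq R n) (r : R).
Hypothesis y0 : y mnm0 = 1.
Hypothesis sq_ge0 : forall s, (msize s <= k.+1)%N -> 0 <= Lf y (s ^+ 2).
Hypothesis ball_ge0 : forall s, (msize s <= k)%N -> 0 <= Lf y (ballpoly r * s ^+ 2).

(** Variables are peeled off one at a time: the ball constraint is tested on the smaller monomial,
    and the nonnegative terms of the other coordinates are dropped. *)
Lemma moment_sqr_bound a : (mdeg a <= k)%N -> Lf y (mpolyX R a ^+ 2) <= (r ^+ 2) ^+ mdeg a.
Proof.
have [t] := ubnP (mdeg a); elim: t a => // t IH a; rewrite ltnS => at' ak.
have [a0|] := posnP (mdeg a).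
  move/eqP: (a0); rewrite mdeg_eq0 => /eqP ->.
  by rewrite mpolyX0 expr1n -mpolyX0 LfX y0 mdeg0 expr0.
move=> /mdeg_gt0_split [i [b ab]]; move: at' ak; rewrite ab mdegD mdeg1 add1n => bt bk.
apply: (@le_trans _ _ (r ^+ 2 * Lf y (mpolyX R b ^+ 2))); last first.
  by rewrite [leRHS]exprS ler_wpM2l ?sqr_ge0 // IH // ltnW.
have := ball_ge0 (s := mpolyX R b); rewrite msizeX => /(_ bk).
rewrite /ballpoly mulrBl mul_mpolyC mulr_suml raddfB /= LfZ subr_ge0.
apply: le_trans; rewrite (bigD1 i) //= raddfD /= -exprMn -mpolyXD lerDl raddf_sum /=.
apply: sumr_ge0 => j _; rewrite -exprMn -mpolyXD; apply: sq_ge0.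
by rewrite msizeX mdegD mdeg1 add1n ltnS.
Qed.

(** The variance of the monomial, the value at the square of [mpolyX R a - mpolyC n (y a)], is
    nonnegative. *)
Lemma moment_bound a : (mdeg a <= k)%N -> `|y a| <= `|r| ^+ mdeg a.
Proof.
move=> ak; rewrite -(@ler_pXn2r _ 2) ?nnegrE ?exprn_ge0 //.
rewrite -normrX ger0_norm ?sqr_ge0 // -exprM mulnC exprM -normrX.
rewrite (ger0_norm (sqr_ge0 r)); apply: le_trans (moment_sqr_bound ak).
have := sq_ge0 (s := mpolyX R a - mpolyC n (y a)).
have -> : (msize (mpolyX R a - mpolyC n (y a)) <= k.+1)%N.
  apply: leq_trans (mmeasureD_le _ _ _) _; rewrite geq_max msizeX ltnS ak /=.
  by rewrite mmeasureN mmeasureC; case: (y a != 0).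
move=> /(_ isT); have -> : (mpolyX R a - mpolyC n (y a)) ^+ 2 =
   mpolyX R a ^+ 2 - (2 * y a) *: mpolyX R a + mpolyC n (y a ^+ 2).
  rewrite sqrrB [mpolyX R a * _]mulrC mul_mpolyC scalerMnl -mulr_natl.
  by rewrite [in RHS]rmorphXn.
rewrite raddfD raddfB /= LfZ LfC LfX y0; lra.
Qed.
End BallBound.

(* The ratios u (m+1) / u m increase, so the first one is at most the growth rate. *)
Lemma logconvex_ratio (u : nat -> R) (K r : R) : 0 < r -> (forall m, 0 <= u m) ->
  (forall m, u m.+1 ^+ 2 <= u m * u m.+2) -> (forall m, u m <= K * r ^+ m) ->
  u 1%N <= r * u 0%N.
Proof.
move=> r0 u0 uc uK; rewrite leNgt; apply/negP => ru.
have u1 : 0 < u 1%N by apply: le_lt_trans ru; rewrite mulr_ge0 // ltW.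
have u00 : 0 < u 0%N.
  rewrite lt_def u0 andbT; apply/eqP => e; have := uc 0%N.
  by rewrite e mul0r leNgt exprn_gt0.
pose c := u 1%N / u 0%N.
have rc : r < c by rewrite /c ltr_pdivlMr.
have c0 : 0 < c by apply: lt_trans rc.
have step m : 0 < u m /\ c * u m <= u m.+1.
  elim: m => [|m [um cm]]; first by rewrite /c divfK // gt_eqF.
  have um1 : 0 < u m.+1 by apply: lt_le_trans cm; rewrite mulr_gt0.
  split=> //; rewrite -(ler_pM2l um); apply: le_trans (uc m).
  by rewrite expr2 mulrA [u m * c]mulrC ler_pM2r.
have grow m : u 0%N * c ^+ m <= u m.
  elim: m => [|m IH]; first by rewrite mulr1.
  by rewrite exprS mulrCA; apply: le_trans (proj2 (step m)); rewrite ler_pM2l.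
have cv : (fun m => K * (r / c) ^+ m) @ \oo --> K * 0.
  apply: cvgM; first exact: cvg_cst.
  by apply: cvg_expr; rewrite gtr0_norm ?divr_gt0 // ltr_pdivrMr // mul1r.
have : u 0%N <= K * 0.
  apply: (rcvg_ge cv); near=> m => /=.
  rewrite expr_div_n mulrA ler_pdivlMr ?exprn_gt0 //.
  exact: le_trans (grow m) (uK m).
by rewrite mulr0 leNgt u00.
Unshelve. all: by end_near.
Qed.

Definition sqpos y := forall s, 0 <= Lf y (s ^+ 2).

Lemma cauchy_schwarz y p q : sqpos y ->
  Lf y (p * q) ^+ 2 <= Lf y (p ^+ 2) * Lf y (q ^+ 2).
Proof.
move=> yp; set A := Lf y (p ^+ 2); set B := Lf y (p * q); set C := Lf y (q ^+ 2).
have h (u v : R) : 0 <= u ^+ 2 * A + 2 * (u * v * B) + v ^+ 2 * C.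
  have -> : u ^+ 2 * A + 2 * (u * v * B) + v ^+ 2 * C =
      Lf y ((u *: p + v *: q) ^+ 2).
    have -> : (u *: p + v *: q) ^+ 2 =
      u ^+ 2 *: p ^+ 2 + (2 * (u * v)) *: (p * q) + v ^+ 2 *: q ^+ 2.
      rewrite sqrrD !exprZn -scalerAl -scalerAr scalerA mulrDl mul1r scalerDl.
      by rewrite mulr2n.
    by rewrite !raddfD /= !LfZ /A /B /C; ring.
  exact: yp.
have A0 : 0 <= A := yp p; have C0 : 0 <= C := yp q.
have [Az|An] := eqVneq A 0.
  rewrite Az mul0r; apply: contrapT => /negP; rewrite -ltNge => B2.
  (* With [A = 0] the form is affine in its first argument; this choice gives it the value -1. *)
  have := h (- (C + 1) / (2 * B)) 1.
  have Bn : B != 0 by apply: contraTN B2 => /eqP ->; rewrite expr0n ltxx.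
  have -> : (- (C + 1) / (2 * B)) ^+ 2 * A + 2 * (- (C + 1) / (2 * B) * 1 * B) +
    1 ^+ 2 * C = - 1 by rewrite Az; field.
  by rewrite leNgt ltrN10.
have Ap : 0 < A by rewrite lt_def An.
have := h (- B) A.
have -> : (- B) ^+ 2 * A + 2 * (- B * A * B) + A ^+ 2 * C = A * (A * C - B ^+ 2) by ring.
by rewrite pmulr_rge0 // subr_ge0.
Qed.

Lemma Lf_norm_le y (w : multinom n -> R) p : (forall a, `|y a| <= w a) ->
  `|Lf y p| <= \sum_(a <- msupp p) `|mcoeff a p| * w a.
Proof.
move=> yw; apply: le_trans (ler_norm_sum _ _ _) _; apply: ler_sum => a _.
by rewrite normrM ler_wpM2l.
Qed.

(** The values at [(x ^+ m * s) ^+ 2] are log-convex in [m] by Cauchy-Schwarz and grow at most at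
    rate [r ^+ 2], so [logconvex_ratio] bounds the first ratio. *)
Lemma sqpos_coord_bound y (C r : R) : 0 < r -> sqpos y ->
  (forall a, `|y a| <= C * r ^+ mdeg a) ->
  forall i s, Lf y (mpolyX R (mnm1 i) ^+ 2 * s ^+ 2) <= r ^+ 2 * Lf y (s ^+ 2).
Proof.
move=> r0 yp yC i s; pose x := mpolyX R (mnm1 i).
pose u m := Lf y ((x ^+ m * s) ^+ 2).
have -> : Lf y (x ^+ 2 * s ^+ 2) = u 1%N by rewrite /u expr1 exprMn.
have -> : Lf y (s ^+ 2) = u 0%N by rewrite /u expr0 mul1r.
pose K := \sum_(a <- msupp (s ^+ 2)) `|mcoeff a (s ^+ 2)| * (C * r ^+ mdeg a).
apply: (@logconvex_ratio u K) => [|m|m|m].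
- exact: exprn_gt0.
- exact: yp.
- have -> : u m.+1 = Lf y ((x ^+ m * s) * (x ^+ m.+2 * s)).
    by rewrite /u; congr (Lf y _); rewrite !exprS; ring.
  exact: cauchy_schwarz.
- apply: le_trans (ler_norm _) _.
  have -> : u m = Lf y (s ^+ 2 * mpolyX R (mnm_muln (mnm1 i) (m * 2))).
    by rewrite /u -mpolyXn mulrC exprMn -exprM mulrC.
  rewrite LfMX; apply: le_trans (ler_norm_sum _ _ _) _.
  rewrite /K mulr_suml; apply: ler_sum => a _; rewrite normrM -mulrA ler_wpM2l //.
  apply: le_trans (yC _) _.
  by rewrite mdegD mdegMn mdeg1 mul1n exprD mulrA -exprM mulnC.
Qed.

Lemma Lf_cvg (U : set_system nat) {UU : UltraFilter U} (z_ : nat -> mseq R n) z p :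
  (forall a, (fun k => z_ k a) @ U --> z a) -> (fun k => Lf (z_ k) p) @ U --> Lf z p.
Proof.
by move=> zz; apply: rcvg_sum => a _; apply: cvgM; [exact: cvg_cst|exact: zz].
Qed.
End MomentFunctional.
Arguments Lf_cvg [R n U] {UU} [z_ z] p _ [t] _.

(** * States of an Archimedean quadratic module *)

Section States.
Variables (R : realType) (n m : nat) (g : 'I_m -> mpoly n R) (r : R) (jb : 'I_m).
Hypothesis ball : g jb = ballpoly n r.
Implicit Types (y z : mseq R n) (p f s : mpoly n R) (a b : multinom n).

Definition state y : Prop :=
  [/\ y mnm0 = 1, sqpos y & forall j s, 0 <= Lf y (g j * s ^+ 2)].

Lemma state_bound y a : state y -> `|y a| <= `|r| ^+ mdeg a.
Proof.
case=> y1 ysq yg; apply: (@moment_bound _ _ (mdeg a) y r y1) => // s _.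
by rewrite -ball.
Qed.

(** The added 1 makes [rho] strictly exceed every first moment of a state, so that the shifts by
    [rho + x_i] and [rho - x_i] can be normalised. *)
Let rho : R := `|r| + 1.

Lemma rho_gt0 : 0 < rho. Proof. by rewrite ltr_wpDl. Qed.

Lemma state_bound_rho y a : state y -> `|y a| <= rho ^+ mdeg a.
Proof.
move=> /state_bound h; apply: le_trans (h a) _.
by rewrite lerXn2r ?nnegrE // ?lerDl // ltW // rho_gt0.
Qed.

Lemma state_coord_bound y h : state y -> sqpos (fun a => Lf y (h * mpolyX R a)) ->
  forall i s, Lf y (h * (mpolyX R (mnm1 i) ^+ 2 * s ^+ 2)) <= rho ^+ 2 * Lf y (h * s ^+ 2).
Proof.
move=> yS; set z := fun a => _; move=> zp i s.
have zE p : Lf y (h * p) = Lf z p.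
  by apply: (LfE (L := fun p => Lf y (h * p))) => c u v; rewrite mulrDr -scalerAr linearP.
rewrite !zE.
pose C := \sum_(b <- msupp h) `|mcoeff b h| * rho ^+ mdeg b.
apply: (@sqpos_coord_bound _ _ z C) => // [|a]; first exact: rho_gt0.
rewrite /z LfMX; apply: le_trans (ler_norm_sum _ _ _) _.
rewrite /C mulr_suml; apply: ler_sum => b _; rewrite normrM -mulrA ler_wpM2l //.
by rewrite -exprD -mdegD; exact: state_bound_rho.
Qed.

(** Both signs are covered by [e ^+ 2 = 1]. The identity [2 rho (rho + e x) = (rho + e x)^2 + (rho^2
    - x^2)] splits the factor into a square and a part controlled by [state_coord_bound]. *)
Lemma state_shift_ge0 y h e i s : state y ->
  (forall s, 0 <= Lf y (h * s ^+ 2)) -> e ^+ 2 = 1 ->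
  0 <= Lf y (h * ((mpolyC n rho + e *: mpolyX R (mnm1 i)) * s ^+ 2)).
Proof.
move=> yS hp e1; set x := mpolyX R (mnm1 i).
have zp : sqpos (fun a => Lf y (h * mpolyX R a)).
  move=> t; rewrite -(LfE (L := fun p => Lf y (h * p))); first exact: hp.
  by move=> c u v; rewrite mulrDr -scalerAr linearP.
have h1 := state_coord_bound yS zp i s; rewrite -/x in h1.
have h2 := hp ((mpolyC n rho + e *: x) * s).
have r0 := rho_gt0.
rewrite -(@pmulr_rge0 _ (2 * rho)) ?mulr_gt0 // -LfZ.
have -> : (2 * rho) *: (h * ((mpolyC n rho + e *: x) * s ^+ 2)) =
   h * ((mpolyC n rho + e *: x) * s) ^+ 2 +
   (rho ^+ 2 *: (h * s ^+ 2) - h * (x ^+ 2 * s ^+ 2)).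
  have xe : x ^+ 2 = (e *: x) ^+ 2 by rewrite exprZn e1 scale1r.
  rewrite -!mul_mpolyC xe.
  have -> : mpolyC n (2 * rho) = 2 * mpolyC n rho by rewrite mpolyCM rmorph_nat.
  have -> : mpolyC n (rho ^+ 2) = mpolyC n rho ^+ 2 by rewrite rmorphXn.
  rewrite -!mul_mpolyC; ring.
by rewrite raddfD raddfB /= LfZ addr_ge0 // subr_ge0.
Qed.

Definition shiftstate y e i : mseq R n := fun a =>
  (rho + e * y (mnm1 i))^-1 * (rho * y a + e * y (mnm_add (mnm1 i) a)).

Lemma coord_lt y i : state y -> `|y (mnm1 i)| < rho.
Proof.
by move=> yS; have := state_bound (mnm1 i) yS; rewrite mdeg1 expr1 /rho => h; lra.
Qed.

Lemma shift_gt0 y e i : state y -> e ^+ 2 = 1 -> 0 < rho + e * y (mnm1 i).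
Proof.
move=> yS e1; have := coord_lt i yS; rewrite ltr_norml => /andP[h1 h2].
have /eqP := e1; rewrite sqrf_eq1 => /orP[] /eqP ->; lra.
Qed.

Lemma state_shift y e i : state y -> e ^+ 2 = 1 -> state (shiftstate y e i).
Proof.
move=> yS e1; have c0 := shift_gt0 i yS e1; set c := _ + _ in c0.
have zE p : Lf (shiftstate y e i) p =
    c^-1 * Lf y ((mpolyC n rho + e *: mpolyX R (mnm1 i)) * p).
  rewrite (LfE (L := fun p => c^-1 * Lf y ((mpolyC n rho + e *: mpolyX R (mnm1 i)) * p))).
    congr (Lf _ p); apply/funext => a; rewrite /shiftstate -/c.
    congr (_ * _); rewrite [in RHS]mulrDl mul_mpolyC -scalerAl -mpolyXD raddfD /=.
    by rewrite !LfZ !LfX.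
  by move=> t u v; rewrite mulrDr -scalerAr linearP mulrDr mulrCA.
have cV : 0 <= c^-1 by rewrite invr_ge0 ltW.
split.
- rewrite /shiftstate addm0 -/c; case: (yS) => -> _ _.
  by rewrite mulr1 mulVf // gt_eqF.
- move=> s; rewrite zE mulr_ge0 //; have := @state_shift_ge0 y 1 e i s yS.
  by rewrite mul1r; apply => // t; rewrite mul1r; case: yS.
- move=> j s; rewrite zE mulr_ge0 // mulrCA; apply: state_shift_ge0 => //.
  by case: yS.
Qed.

Definition extreme y : Prop := forall y1 y2 t, 0 < t -> t < 1 -> state y1 -> state y2 ->
  (forall a, y a = t * y1 a + (1 - t) * y2 a) -> forall a, y1 a = y a.

(* [y] is a convex combination of its shifts by [rho + x_i] and [rho - x_i]. *)
Lemma extreme_mult y i a : state y -> extreme y ->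
  y (mnm_add (mnm1 i) a) = y (mnm1 i) * y a.
Proof.
move=> yS ye; pose c e := rho + e * y (mnm1 i).
have e1 : 1 ^+ 2 = 1 :> R by rewrite expr1n.
have e2 : (-1) ^+ 2 = 1 :> R by rewrite sqrrN expr1n.
have c1 : 0 < c 1 := shift_gt0 i yS e1; have c2 : 0 < c (-1) := shift_gt0 i yS e2.
have r0 := rho_gt0; have r20 : 0 < 2 * rho by rewrite mulr_gt0.
have cc : c 1 + c (-1) = 2 * rho by rewrite /c; ring.
have := @ye _ _ (c 1 / (2 * rho)) _ _ (state_shift i yS e1) (state_shift i yS e2) _ a.
rewrite divr_gt0 // ltr_pdivrMr // mul1r -cc ltrDl c2 cc => /(_ isT isT) h.
have {}h : shiftstate y 1 i a = y a.
  apply: h => b; have -> : 1 - c 1 / (2 * rho) = c (-1) / (2 * rho).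
    by rewrite -cc; field; rewrite cc gt_eqF.
  rewrite /shiftstate -/(c 1) -/(c (-1)); field.
  by rewrite !gt_eqF.
move: h; rewrite /shiftstate -/(c 1) => /(congr1 ( *%R (c 1))).
rewrite mulrA divff ?gt_eqF // mul1r /c; lra.
Qed.

Lemma extreme_eval y p : state y -> extreme y ->
  Lf y p = peval p (\row_i y (mnm1 i)).
Proof.
move=> yS ye; rewrite /peval mevalE /Lf; apply: eq_bigr => a _; congr (_ * _).
have [t] := ubnP (mdeg a); elim: t a => // t IH a; rewrite ltnS => ta.
have [/eqP|] := posnP (mdeg a).
  rewrite mdeg_eq0 => /eqP ->; rewrite big1 => [|i _]; first by case: yS.
  by rewrite mnm0E expr0.
move=> /mdeg_gt0_split [i [b ab]]; move: ta; rewrite ab mdegD mdeg1 add1n => bt.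
rewrite extreme_mult // (IH _ bt) [RHS](bigD1 i) //= (bigD1 i) //= mulrA.
rewrite mnmDE mnm1E eqxx add1n exprS mxE; congr (_ * _).
by apply: eq_bigr => j ji; rewrite mnmDE mnm1E eq_sym (negbTE ji).
Qed.

Lemma extreme_semialg y : state y -> extreme y ->
  semialg g (\row_i y (mnm1 i)).
Proof.
move=> yS ye j; rewrite -extreme_eval //.
by case: yS => _ _ /(_ j 1); rewrite expr1n mulr1.
Qed.

Section UltraLimit.
Variable U : set_system nat.
Context {UU : UltraFilter U}.

Lemma state_lim (z_ : nat -> mseq R n) : (forall k, state (z_ k)) ->
  exists z, state z /\ forall a, (fun k => z_ k a) @ U --> z a.
Proof.
move=> zS; have h a : exists l : R, (fun k => z_ k a) @ U --> l.
  apply: (@cvg_ultra_bounded _ _ _ _ (`|r| ^+ mdeg a)).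
  by apply: filterS filterT => k _ /=; exact: state_bound.
pose z a := proj1_sig (cid (h a)); exists z.
have zz a : (fun k => z_ k a) @ U --> z a := proj2_sig (cid (h a)).
split=> //; split.
- by apply: (rcvg_eq (zz mnm0)); apply: filterS filterT => k _ /=; case: (zS k).
- move=> s; apply: (rcvg_ge (Lf_cvg (s ^+ 2) zz)).
  by apply: filterS filterT => k _ /=; case: (zS k).
- move=> j s; apply: (rcvg_ge (Lf_cvg (g j * s ^+ 2) zz)).
  by apply: filterS filterT => k _ /=; case: (zS k).
Qed.
End UltraLimit.

(** * Successive minimisation over nested faces of the set of states *)

Section Lexicographic.
Variable e : nat -> mpoly n R.

(* The intersection of these nested faces consists of extreme states when [e] runs over
   all monomials; this avoids both Zorn's lemma and the Krein-Milman theorem. *)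
Fixpoint lexmin k : set (mseq R n) :=
  if k is k'.+1 then
    [set z | lexmin k' z /\ forall z', lexmin k' z' -> Lf z (e k') <= Lf z' (e k')]
  else state.

Lemma lexmin_state k z : lexmin k z -> state z.
Proof. by elim: k z => [|k IH] z //= -[/IH]. Qed.

Lemma lexmin_le k k' : (k <= k')%N -> lexmin k' `<=` lexmin k.
Proof.
move=> /subnK <-; elim: (k' - k)%N => // t IH z.
by rewrite addSn /= => -[/IH].
Qed.

Lemma lexmin_closed (U : set_system nat) {UU : UltraFilter U} k (z_ : nat -> mseq R n) z :
  (forall a, (fun t => z_ t a) @ U --> z a) -> state z ->
  U [set t | lexmin k (z_ t)] -> lexmin k z.
Proof.
move=> zz zS; elim: k => [//|k IH] /= Uz; split.
  by apply: IH; apply: filterS Uz => t [].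
move=> z' kz'; apply: (rcvg_le (Lf_cvg (e k) zz)).
by apply: filterS Uz => t /= [_]; apply.
Qed.

Lemma lexmin_neq0 y k : state y -> lexmin k !=set0.
Proof.
move=> yS; elim: k => [|k [w kw]]; first by exists y.
pose E := [set Lf z (e k) | z in lexmin k].
pose B := \sum_(a <- msupp (e k)) `|mcoeff a (e k)| * `|r| ^+ mdeg a.
have El : has_lbound E.
  exists (- B) => _ [z kz <-].
  have : `|Lf z (e k)| <= B.
    by apply: Lf_norm_le => a; apply: state_bound; exact: lexmin_state kz.
  by rewrite ler_norml => /andP[].
have E0 : has_inf E by split=> //; exists (Lf w (e k)), w.
have hz t : exists z, lexmin k z /\ Lf z (e k) < inf E + t.+1%:R^-1.
  have t0 : 0 < t.+1%:R^-1 :> R by rewrite invr_gt0.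
  by have [_ [z kz <-] lt] := inf_adherent t0 E0; exists z.
pose z_ t := proj1_sig (cid (hz t)).
have zk t : lexmin k (z_ t) := proj1 (proj2_sig (cid (hz t))).
have zl t : Lf (z_ t) (e k) < inf E + t.+1%:R^-1 := proj2 (proj2_sig (cid (hz t))).
have [U [UU sU]] := ultraFilterLemma (eventually_filter : ProperFilter \oo).
have [z [zS zz]] := @state_lim U UU z_ (fun t => lexmin_state (zk t)).
exists z; split.
  by apply: (lexmin_closed zz zS); apply: filterS filterT => t _ /=; exact: zk.
move=> z' kz'; apply: (@le_trans _ _ (inf E)); last by apply: ge_inf => //; exists z'.
have c2 : (fun t => inf E + t.+1%:R^-1) @ U --> inf E + 0.
  apply: cvgD; first exact: cvg_cst.
  by move=> W Wn; apply: sU; exact: cvg_harmonic Wn.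
rewrite -[inf E]addr0; apply: (ler_cvg_to (Lf_cvg (e k) zz) c2).
by apply: filterS filterT => t _ /=; exact: ltW.
Qed.

(** One state is chosen in each face; as the faces are nested and closed, the limit along an
    ultrafilter lies in all of them. *)
Lemma lexmin_inter y : state y -> exists z, forall k, lexmin k z.
Proof.
move=> yS; pose z_ k := proj1_sig (cid (lexmin_neq0 k yS)).
have zk k : lexmin k (z_ k) := proj2_sig (cid (lexmin_neq0 k yS)).
have [U [UU sU]] := ultraFilterLemma (eventually_filter : ProperFilter \oo).
have [z [zS zz]] := @state_lim U UU z_ (fun t => lexmin_state (zk t)).
exists z => k; apply: (lexmin_closed zz zS); apply: sU.
by exists k => // t /= kt; exact: lexmin_le kt _ (zk t).
Qed.

(** Where a proper convex combination attains a minimum, both of its components attain it too. *)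
Lemma lexmin_face z y1 y2 t : (forall k, lexmin k z) -> 0 < t -> t < 1 ->
  state y1 -> state y2 -> (forall a, z a = t * y1 a + (1 - t) * y2 a) ->
  forall k, [/\ lexmin k y1, lexmin k y2 & Lf y1 (e k) = Lf z (e k)].
Proof.
move=> zk t0 t1 S1 S2 zE.
have LE p : Lf z p = t * Lf y1 p + (1 - t) * Lf y2 p.
  by rewrite /Lf !mulr_sumr -big_split; apply: eq_bigr => a _ /=; rewrite zE; ring.
have step k : lexmin k y1 -> lexmin k y2 ->
    Lf y1 (e k) = Lf z (e k) /\ Lf y2 (e k) = Lf z (e k).
  move=> k1 k2; have [_ zmin] := zk k.+1; have := LE (e k).
  have := zmin _ k1; have := zmin _ k2.
  move: (Lf z _) (Lf y1 _) (Lf y2 _) => u v w h1 h2 h3; split; nra.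
have K k : lexmin k y1 /\ lexmin k y2.
  elim: k => [//|k [k1 k2]]; have [e1 e2] := step k k1 k2.
  have [_ zmin] := zk k.+1.
  by split; split=> // z' kz'; rewrite ?e1 ?e2; exact: zmin.
by move=> k; have [k1 k2] := K k; split=> //; case: (step k k1 k2).
Qed.
End Lexicographic.

(* An extreme state minimising [f] is a point evaluation. *)
Lemma state_nonneg y f : state y -> (forall x, semialg g x -> 0 <= peval f x) ->
  0 <= Lf y f.
Proof.
move=> yS fX.
(* With [f] first, [z] minimises [f] over all states; the monomials that follow make [z] extreme.
   Codes of no exponent give the zero polynomial. *)
pose e k := if k is k'.+1 then oapp (mpolyX R) 0 (unpickle k' : option (multinom n)) else f.
have [z zk] := lexmin_inter e yS.
have zS : state z := zk 0%N.
have ze : extreme z.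
  move=> y1 y2 t t0 t1 S1 S2 zE a.
  have [_ _] := lexmin_face zk t0 t1 S1 S2 zE (pickle a).+1.
  by rewrite /e pickleK /= !LfX.
apply: (@le_trans _ _ (Lf z f)); last by case: (zk 1%N) => _; apply.
by rewrite extreme_eval //; apply: fX; exact: extreme_semialg.
Qed.
End States.

(** * Convex hull of a compact curve *)

Section ConvexHull.
Variables (R : realType) (T : topologicalType) (X : set T) (N : nat).
Variables (w : T -> 'rV[R]_N) (i0 : 'I_N).
Hypothesis w1 : forall x, w x 0 i0 = 1.

Definition wsum k (c : 'I_k -> R) (x : 'I_k -> T) : 'rV[R]_N :=
  \sum_i c i *: w (x i).

(** This is the conic hull: the weights are not normalised, and [N] points suffice for a cone in
    dimension [N]. Coordinate [i0] records the total weight, so [hull1] is the convex hull. *)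
Definition hull : set 'rV[R]_N :=
  [set v | exists (c : 'I_N -> R) (x : 'I_N -> T),
    [/\ forall i, 0 <= c i, forall i, X (x i) & v = wsum c x]].

Lemma caratheodory_step (c : 'I_N.+1 -> R) (x : 'I_N.+1 -> T) :
  (forall i, 0 <= c i) -> (forall i, X (x i)) -> hull (wsum c x).
Proof.
move=> c0 Xx; pose A : 'M[R]_(N.+1, N) := \matrix_(i, j) w (x i) 0 j.
have [u un0 uA] : exists2 u : 'rV[R]_N.+1, u != 0 & u *m A = 0.
  have : kermx A != 0.
    rewrite kermx_eq0 /row_free neq_ltn.
    by rewrite (leq_ltn_trans (rank_leq_col A)).
  move=> /rowV0Pn [u /sub_kermxP uA un0]; by exists u.
have usum j : \sum_i u 0 i * w (x i) 0 j = 0.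
  have /matrixP/(_ 0 j) := uA; rewrite [RHS]mxE [LHS]mxE; apply: etrans.
  by apply: eq_bigr => i _; rewrite mxE.
have u0 : \sum_i u 0 i = 0.
  by rewrite -[RHS](usum i0); apply: eq_bigr => i _; rewrite w1 mulr1.
have [i1 u1] : exists i, 0 < u 0 i.
  apply: contrapT => h; move/negP: un0; apply; apply/eqP/rowP => i; rewrite mxE.
  have h' i' : 0 <= - u 0 i'.
    by rewrite oppr_ge0 leNgt; apply/negP => ui; apply: h; exists i'.
  have /eqP : \sum_i - u 0 i = 0 by rewrite sumrN u0 oppr0.
  rewrite psumr_eq0 // => /allP/(_ i); rewrite mem_index_enum => /(_ isT).
  by rewrite oppr_eq0 => /eqP.
(* Subtracting the dependency [u], scaled by the smallest ratio over its positive entries, keeps the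
   weights nonnegative and makes one of them zero. *)
case: (@Order.TotalTheory.arg_minP _ _ _ i1 (fun i => 0 < u 0 i) (fun i => c i / u 0 i) u1).
move=> k uk kmin; pose t := c k / u 0 k.
have t0 : 0 <= t by rewrite divr_ge0 // ltW.
pose c' i := c i - t * u 0 i.
have c'0 i : 0 <= c' i.
  rewrite /c' subr_ge0; have [ui|ui] := ltP 0 (u 0 i).
    by rewrite -ler_pdivlMr //; exact: kmin.
  by apply: le_trans (c0 i); rewrite mulr_ge0_le0.
have c'k : c' k = 0 by rewrite /c' /t divfK ?subrr // gt_eqF.
exists (fun j => c' (lift k j)), (fun j => x (lift k j)); split => //.
have -> : wsum c x = wsum c' x.
  apply/rowP => j; rewrite /wsum !summxE.
  have -> : \sum_i (c' i *: w (x i)) 0 j = \sum_i (c i *: w (x i)) 0 j -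
      t * \sum_i u 0 i * w (x i) 0 j.
    by rewrite mulr_sumr -sumrB; apply: eq_bigr => i _; rewrite !mxE /c'; ring.
  by rewrite usum mulr0 subr0.
by rewrite {1}/wsum (bigD1_ord k) //= c'k scale0r add0r.
Qed.

Definition sqdist (u v : 'rV[R]_N) : R := \sum_j (u 0 j - v 0 j) ^+ 2.

Hypothesis cX : compact X.
Hypothesis wc : forall j, continuous (fun x => w x 0 j).
Hypothesis X0 : X !=set0.

Definition hull1 : set 'rV[R]_N := [set v | hull v /\ v 0 i0 = 1].

Lemma hull_wsum0 (c : 'I_N -> R) x : wsum c x 0 i0 = \sum_i c i.
Proof. by rewrite summxE; apply: eq_bigr => i _; rewrite mxE w1 mulr1. Qed.

Lemma hull1_w x : X x -> hull1 (w x).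
Proof.
move=> Xx; split=> //; exists (fun i => (i == i0)%:R), (fun=> x); split=> //.
rewrite /wsum (bigD1 i0) //= eqxx scale1r big1 ?addr0 // => i /negbTE ->.
by rewrite scale0r.
Qed.

Lemma hull1_segment v x t : hull1 v -> X x -> 0 <= t -> t <= 1 ->
  hull1 (v + t *: (w x - v)).
Proof.
move=> [[c [y [c0 Xy vE]]] v1] Xx t0 t1; split; last first.
  by rewrite !mxE v1 w1 subrr mulr0 addr0.
pose c' i := oapp (fun j => (1 - t) * c j) t (unlift (ord0 : 'I_N.+1) i).
pose y' i := oapp y x (unlift (ord0 : 'I_N.+1) i).
have -> : v + t *: (w x - v) = wsum c' y'.
  rewrite /wsum (bigD1_ord ord0) //= /c' /y' unlift_none /=.
  rewrite (eq_bigr (fun j => (1 - t) *: (c j *: w (y j)))); last first.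
    by move=> j _; rewrite liftK /= scalerA.
  rewrite -scaler_sumr -/(wsum c y) -vE scalerBr scalerBl scale1r.
  by rewrite addrCA.
apply: caratheodory_step => i; rewrite /c' /y'; case: (unlift _ _) => [j|] //=.
by rewrite mulr_ge0 // subr_ge0.
Qed.

(** The number of points is fixed, the weights lie in [[0, 1]] and the points in a compact set, so a
    minimising sequence has a limit of the same form. *)
Lemma hull1_closest (v : 'rV[R]_N) : exists p, hull1 p /\ forall z, hull1 z -> sqdist p v <= sqdist z v.
Proof.
pose E := [set sqdist z v | z in hull1].
have El : has_lbound E.
  by exists 0 => _ [z _ <-]; apply: sumr_ge0 => j _; exact: sqr_ge0.
have E0 : has_inf E.
  by split=> //; have [x Xx] := X0; exists (sqdist (w x) v), (w x) => //; exact: hull1_w.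
have hz t : exists cx : ('I_N -> R) * ('I_N -> T), [/\ forall i, 0 <= cx.1 i,
    forall i, X (cx.2 i), wsum cx.1 cx.2 0 i0 = 1 &
    sqdist (wsum cx.1 cx.2) v < inf E + t.+1%:R^-1].
  have t0 : 0 < t.+1%:R^-1 :> R by rewrite invr_gt0.
  have [_ [z [[c [x [c0 Xx ->]]] z1] <-] lt] := inf_adherent t0 E0.
  by exists (c, x).
have [cx hcx] := choice hz.
have [U [UU sU]] := ultraFilterLemma (eventually_filter : ProperFilter \oo).
have hc i : exists l : R, (fun t => (cx t).1 i) @ U --> l.
  apply: (@cvg_ultra_bounded _ _ _ _ 1); apply: filterS filterT => t _ /=.
  case: (hcx t) => c0 _; rewrite hull_wsum0 => s1 _.
  rewrite ger0_norm ?c0 //; apply: (le_trans _ (_ : \sum_i (cx t).1 i <= 1)); last first.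
    by rewrite s1.
  by rewrite (bigD1 i) //= lerDl; apply: sumr_ge0.
have hx i : exists l, X l /\ (fun t => (cx t).2 i) @ U --> l.
  apply: cvg_ultra_compact => //; apply: filterS filterT => t _ /=.
  by case: (hcx t).
have [c cc] := choice hc; have [x hxx] := choice hx.
have Xx i := proj1 (hxx i); have xx i := proj2 (hxx i).
have c0 i : 0 <= c i.
  by apply: (rcvg_ge (cc i)); apply: filterS filterT => t _ /=; case: (hcx t).
have ww j : (fun t => wsum (cx t).1 (cx t).2 0 j) @ U --> wsum c x 0 j.
  rewrite summxE; under eq_fun do rewrite summxE.
  apply: rcvg_sum => i _; rewrite mxE; under eq_fun do rewrite mxE.
  apply: cvgM; first exact: cc.
  apply: (@continuous_cvg _ _ _ U _ (fun t => (cx t).2 i) (fun y => w y 0 j)).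
    exact: wc.
  exact: xx.
exists (wsum c x); split.
  split; first by exists c, x.
  by apply: (rcvg_eq (ww i0)); apply: filterS filterT => t _ /=; case: (hcx t).
move=> z hz'; apply: (@le_trans _ _ (inf E)); last by apply: ge_inf => //; exists z.
have c1 : (fun t => sqdist (wsum (cx t).1 (cx t).2) v) @ U --> sqdist (wsum c x) v.
  apply: rcvg_sum => j _; apply: (@cvgM _ _ _ _ (fun t => _ - _) (fun t => _ - _));
    by apply: cvgB; [exact: ww|exact: cvg_cst].
have c2 : (fun t => inf E + t.+1%:R^-1) @ U --> inf E + 0.
  apply: cvgD; first exact: cvg_cst.
  by move=> W Wn; apply: sU; exact: cvg_harmonic Wn.
rewrite -[inf E]addr0; apply: (ler_cvg_to c1 c2).
by apply: filterS filterT => t _ /=; apply: ltW; case: (hcx t).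
Qed.

(** The affine form with normal [p - v] that vanishes at the closest point [p] is nonnegative on the
    curve, but its value at [v] is minus the squared distance. *)
Lemma hull1_separation (v : 'rV[R]_N) : (forall h : 'rV[R]_N, forall b,
    (forall x, X x -> 0 <= \sum_j h 0 j * w x 0 j - b) -> 0 <= \sum_j h 0 j * v 0 j - b) ->
  hull1 v.
Proof.
move=> hv; have [p [hp pmin]] := hull1_closest v.
pose h := p - v; pose b := \sum_j h 0 j * p 0 j.
have D0 : sqdist p v = \sum_j h 0 j ^+ 2.
  by apply: eq_bigr => j _; rewrite !mxE.
have hb : 0 <= \sum_j h 0 j * v 0 j - b.
  apply: hv => x Xx; rewrite leNgt; apply/negP => lt0.
  pose e := \sum_j (w x 0 j - p 0 j) ^+ 2.
  have e0 : 0 <= e by apply: sumr_ge0 => j _; exact: sqr_ge0.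
  set a := _ - b in lt0.
  have aE : a = \sum_j h 0 j * (w x 0 j - p 0 j).
    by rewrite /a /b -sumrB; apply: eq_bigr => j _; rewrite mulrBr.
  have key t : 0 <= t -> t <= 1 -> 0 <= t * (2 * a + t * e).
    move=> t0 t1; have := pmin _ (hull1_segment hp Xx t0 t1).
    rewrite D0 -subr_ge0; congr (0 <= _).
    rewrite aE /e /sqdist -sumrB !mulr_sumr -big_split /= mulr_sumr.
    by apply: eq_bigr => j _; rewrite !mxE; ring.
  (* Chosen so that [t <= 1] and [t * e <= - a], whence [2 * a + t * e <= a < 0]. *)
  pose t := - a / (- a + e + 1).
  have d0 : 0 < - a + e + 1 by lra.
  have t0 : 0 < t by rewrite divr_gt0 // oppr_gt0.
  have t1 : t <= 1 by rewrite ler_pdivrMr // mul1r; lra.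
  have := key t (ltW t0) t1; rewrite pmulr_rge0 //; apply/negP; rewrite -ltNge.
  have te : t * e <= - a.
    rewrite /t mulrAC ler_pdivrMr // ler_wpM2l //; lra.
  lra.
have hvb : \sum_j h 0 j * v 0 j - b = - \sum_j h 0 j ^+ 2.
  rewrite /b -sumrB -sumrN; apply: eq_bigr => j _; rewrite !mxE; ring.
suff <- : p = v by [].
apply/eqP; rewrite -subr_eq0 -/h; apply/eqP/rowP => j; rewrite [RHS]mxE.
have s0 : \sum_j h 0 j ^+ 2 = 0.
  apply/eqP; rewrite eq_le; apply/andP; split; first by rewrite -oppr_ge0 -hvb.
  by apply: sumr_ge0 => i _; exact: sqr_ge0.
move/eqP: s0; rewrite psumr_eq0 => [/allP/(_ j)|i _]; last exact: sqr_ge0.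
by rewrite mem_index_enum => /(_ isT); rewrite sqrf_eq0 => /eqP.
Qed.
End ConvexHull.

(** * Moments of measures *)

Section Moments.
Import measurable_realfun.
Variables (R : realType) (n : nat).
Implicit Types (a b : multinom n) (p f s : mpoly n R).

Lemma xmono_continuous a : continuous (xmono a : 'rV[R]_n -> R).
Proof.
move=> x; apply: (@rcvg_prod R 'rV[R]_n (nbhs x) _ 'I_n _ _ (fun i z => z 0 i ^+ a i)) => i _.
apply: (@continuous_comp _ _ _ (fun z : 'rV[R]_n => z 0 i) (fun t : R => t ^+ a i)).
  exact: coord_continuous.
exact: exprn_continuous.
Qed.

Lemma pevalE p (x : 'rV[R]_n) : peval p x = \sum_(a <- msupp p) mcoeff a p * xmono a x.
Proof. by []. Qed.

Lemma pevalX a (x : 'rV[R]_n) : peval (mpolyX R a) x = xmono a x.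
Proof. exact: mevalX. Qed.

Lemma peval_continuous p : continuous (peval p : 'rV[R]_n -> R).
Proof.
move=> x; apply: (@rcvg_sum R 'rV[R]_n (nbhs x) _ _ (msupp p) _
  (fun a z => mcoeff a p * xmono a z)) => a _.
by apply: cvgM; [exact: cvg_cst|exact: xmono_continuous].
Qed.

Lemma semialg_closed m (g : 'I_m -> mpoly n R) : closed (semialg g).
Proof.
have -> : semialg g = \bigcap_(j in setT) (peval (g j) @^-1` [set t : R | 0 <= t]).
  by apply/seteqP; split => x h j; [move=> _; exact: h|exact: (h j)].
apply: closed_bigI => j _; apply: preimage_closed; last exact: closed_ge.
by move=> x _; exact: peval_continuous.
Qed.

Lemma closed_borel (A : set 'rV[R]_n) : closed A -> measurable (A : set (borelRn R n)).
Proof.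
move=> cA; rewrite -[A]setCK; apply: measurableC.
by apply: sub_sigma_algebra; exact: closed_openC.
Qed.

Lemma continuous_borel (D : set (borelRn R n)) (h : 'rV[R]_n -> R) :
  measurable D -> continuous h -> measurable_fun D (h : borelRn R n -> R).
Proof.
move=> mD ch; apply: (measurability _ (RGenOpens.measurableE R)).
move=> _ [_ [a [b ->] <-]]; apply: measurableI => //.
have oh : open (h @^-1` `]a, b[%classic).
  by move/continuousP : ch; apply; exact: interval_open.
by apply: sub_sigma_algebra; exact: oh.
Qed.

Lemma midx_surj k a : (mdeg a <= k)%N -> exists i : 'I_(smon n k), midx i = a.
Proof.
rewrite -ltnS => ak; exists (enum_rank (BMultinom ak)).
by rewrite /midx enum_rankK.
Qed.

Lemma integral_atomic d (T : measurableType d) (D : set T) N (c : nat -> {nonneg R})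
    (x : nat -> T) (h : T -> R) : measurable D -> measurable_fun D h ->
  (forall k, D (x k)) ->
  (\int[msum (fun k => mscale (c k) (dirac (x k))) N]_(t in D) (h t)%:E =
   (\sum_(k < N) (c k)%:num * h (x k))%:E)%E.
Proof.
move=> mD mh Dx.
have mE : measurable_fun D (EFin \o h) by exact/measurable_EFinP.
have ge0 (f : T -> \bar R) : measurable_fun D f -> (forall t, (0 <= f t)%E) ->
  (\int[msum (fun k => mscale (c k) (dirac (x k))) N]_(t in D) f t =
   \sum_(k < N) (c k)%:num%:E * f (x k))%E.
  move=> mf f0; rewrite ge0_integral_measure_sum //; apply: eq_bigr => k _.
  rewrite ge0_integral_mscale // integral_dirac //.
  by rewrite diracE mem_set ?mul1e.
(* The integrand may change sign, so the formula for nonnegative functions is applied to its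
   positive and negative parts. *)
rewrite integralE !ge0 //; [|exact: measurable_funeneg|exact: measurable_funepos].
have pE (t : T) : ((EFin \o h)^\+ t = (Num.max (h t) 0)%:E)%E by rewrite funeposE /= EFin_max.
have nE (t : T) : ((EFin \o h)^\- t = (Num.max (- h t) 0)%:E)%E by rewrite funenegE /= EFin_max.
rewrite (eq_bigr (fun k : 'I_N => ((c k)%:num * Num.max (h (x k)) 0)%:E)); last first.
  by move=> k _; rewrite pE EFinM.
rewrite [X in (_ - X)%E](eq_bigr (fun k : 'I_N => ((c k)%:num * Num.max (- h (x k)) 0)%:E)); last first.
  by move=> k _; rewrite nE EFinM.
rewrite !sumEFin -EFinB -sumrB; congr EFin; apply: eq_bigr => k _.
rewrite -mulrBr; congr (_ * _); rewrite /Num.max.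
by case: ifP; case: ifP; lra.
Qed.

(** * Correspondence between states and moment sequences of measures on X *)

Section StatesAndMeasures.
Variables (m : nat) (g : 'I_m -> mpoly n R) (r : R) (jb : 'I_m).
Hypothesis ball : g jb = ballpoly n r.
Hypothesis cX : compact (semialg g).
Hypothesis X0 : semialg g !=set0.

(** An affine form that is nonnegative on the moment curve is a polynomial nonnegative on X, hence
    nonnegative at the state; separation places the truncated moments in the hull, whose weights and
    points give the atoms. *)
Lemma state_is_moment_seq d (y : mseq R n) : state g y -> is_moment_seq (semialg g) d y.
Proof.
move=> yS; pose N := smon n (2 * d).
pose w (x : 'rV[R]_n) : 'rV[R]_N := \row_i xmono (midx i) x.
have [i0 i0E] : exists i : 'I_N, midx i = mnm0 by apply: midx_surj; rewrite mdeg0.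
have w1 x : w x 0 i0 = 1.
  by rewrite mxE i0E /xmono big1 // => i _; rewrite mnm0E expr0.
have wc j : continuous (fun x => w x 0 j).
  have -> : (fun x => w x 0 j) = xmono (midx j) by apply/funext => x; rewrite mxE.
  exact: xmono_continuous.
pose v : 'rV[R]_N := \row_i y (midx i).
have [[c [x [c0 Xx vE]]] _] : hull1 (semialg g) w i0 v.
  apply: hull1_separation => // h b hX.
  pose f := \sum_j h 0 j *: mpolyX R (midx j) - mpolyC n b.
  have -> : \sum_j h 0 j * v 0 j - b = Lf y f.
    rewrite /f raddfB /= raddf_sum /= LfC; case: (yS) => -> _ _; rewrite mulr1.
    by congr (_ - _); apply: eq_bigr => j _; rewrite LfZ LfX mxE.
  apply: (state_nonneg ball) => // t /hX; rewrite /peval /f mevalB mevalC raddf_sum /=.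
  congr (0 <= _ - _); apply: eq_bigr => j _.
  by rewrite mevalZ mxE -pevalX.
have [x0 Xx0] := X0.
pose c' k : {nonneg R} := oapp (fun i : 'I_N => NngNum (c0 i)) (NngNum (lexx 0)) (insub k).
pose x' k : borelRn R n := oapp x x0 (insub k : option 'I_N).
exists (msum (fun k => mscale (c' k) (dirac (x' k))) N) => a ad.
rewrite integral_atomic.
- have [j <-] := midx_surj ad; congr EFin.
  have /rowP/(_ j) := vE; rewrite mxE => ->; rewrite summxE.
  by apply: eq_bigr => i _; rewrite !mxE /c' /x' valK.
- exact: closed_borel (@semialg_closed _ g).
- by apply: continuous_borel; [exact: closed_borel (@semialg_closed _ g)|exact: xmono_continuous].
- by move=> k; rewrite /x'; case: (insub _) => [i|] //=.
Qed.

(** On the compact set X all monomials are bounded, and the measure of X is [y mnm0 = 1]; hence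
    moments of every order exist and extend the truncated sequence. *)
Lemma moment_seq_state d (y : mseq R n) : is_moment_seq (semialg g) d y -> normalized y ->
  exists yd, state g yd /\ forall a, (mdeg a <= 2 * d)%N -> yd a = y a.
Proof.
move=> [mu muE] y1; pose X : set (borelRn R n) := semialg g.
have mX : measurable X by exact: closed_borel (@semialg_closed _ g).
have muX : mu X = 1%E.
  have := muE mnm0; rewrite mdeg0 y1 => /(_ isT) ->.
  rewrite -[LHS]mul1e -integral_cst //; apply: eq_integral => x _.
  by rewrite /xmono big1 // => i _; rewrite mnm0E expr0.
have intX a : mu.-integrable X (EFin \o (xmono a : borelRn R n -> R)).
  apply: measurable_bounded_integrable => //; first by rewrite muX ltry.
    by apply: continuous_borel => //; exact: xmono_continuous.
  have : bounded_set (xmono a @` (semialg g) : set R^o).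
    apply: (@compact_bounded R R^o); apply: continuous_compact; last exact: cX.
    by apply: continuous_subspaceT; exact: xmono_continuous.
  by move=> [M [Mr hM]]; exists M; split=> // t Mt x Xx; apply: (hM t Mt); exists x.
pose yd : mseq R n := fun a => fine (\int[mu]_(x in X) (xmono a x)%:E)%E.
have ydE a : ((yd a)%:E = \int[mu]_(x in X) (xmono a x)%:E)%E.
  by rewrite fineK //; by move: (integrable_fin_num mX (intX a)).
have LE p : ((Lf yd p)%:E = \int[mu]_(x in X) (peval p x)%:E)%E.
  transitivity (\int[mu]_(x in X) \sum_(a <- msupp p) ((mcoeff a p)%:E * (xmono a x)%:E))%E.
    rewrite integral_sum //; last first.
      by move=> a; apply: integrableZl => //; exact: intX.
    rewrite -sumEFin; apply: eq_bigr => a _.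
    rewrite EFinM ydE; exact: esym (integralZl mX (intX a) _).
  by apply: eq_integral => x _; rewrite pevalE -sumEFin; apply: eq_bigr.
have Lge0 p : (forall x, X x -> 0 <= peval p x) -> 0 <= Lf yd p.
  by move=> p0; rewrite -lee_fin LE; apply: integral_ge0 => x Xx; rewrite lee_fin p0.
exists yd; split; last by move=> a /muE e; rewrite /yd -e.
split.
- by rewrite /yd -muE ?mdeg0.
- by move=> s; apply: Lge0 => x _; rewrite /peval rmorphXn sqr_ge0.
- move=> j s; apply: Lge0 => x Xx; rewrite /peval rmorphM rmorphXn mulr_ge0 ?sqr_ge0 //.
  exact: Xx.
Qed.
End StatesAndMeasures.
End Moments.

(** * Moment relaxations *)

Lemma mxpowr_mul_tr (R : realType) (p : nat) (q : R) (A : 'M[R]_p) : pdmx A ->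
  \tr (mxpowr A (q - 1) *m A) = \tr (mxpowr A q).
Proof.
move=> /pdmx_pdiag [V [a hA]]; rewrite (pdiag_tr hA).
rewrite (mxpowrE _ (pdiag_orth_diag hA)); case: hA => V1 -> a0.
rewrite tr_diag_conj V1; apply: eq_bigr => i _; rewrite (bigD1 i) //= big1 => [|j ji].
  rewrite !mxE eqxx expr1n mulr1 addr0 !powR_expR // -{2}[a 0 i]lnK ?posrE //.
  by rewrite -expRD; congr expR; ring.
by rewrite !mxE eq_sym (negbTE ji) expr0n mulr0.
Qed.

Definition mid (R : realType) (p : nat) (A B : 'M[R]_p) : 'M[R]_p := 2^-1 *: (A + B).

Lemma qform_mid (R : realType) (p : nat) (A B : 'M[R]_p) v :
  qform (mid A B) v = (qform A v + qform B v) / 2.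
Proof.
rewrite /qform /mid -scalemxAr -scalemxAl mulmxDr mulmxDl.
by rewrite [LHS]mxE [(_ + _ : 'M[R]_1) 0 0]mxE mulrC.
Qed.

Lemma pdmx_mid (R : realType) (p : nat) (A B : 'M[R]_p) :
  psdmx A -> pdmx B -> pdmx (mid A B).
Proof.
move=> [sA pA] [sB pB]; split.
  apply/matrixP => i j; move/matrixP/(_ i j): sA; move/matrixP/(_ i j): sB.
  by rewrite !mxE => -> ->.
move=> v v0; rewrite -/(qform _ _) qform_mid divr_gt0 // ltr_wpDl //; first exact: pA.
exact: pB.
Qed.

Lemma pdmx_psdmx (R : realType) (p : nat) (A : 'M[R]_p) : pdmx A -> psdmx A.
Proof.
move=> [sA pA]; split=> // v; have [->|v0] := eqVneq v 0; last exact/ltW/pA.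
by rewrite mulmx0 mxE.
Qed.

(** In the sum of the tangent inequalities at the midpoint towards [A] and [B], the linear terms
    cancel. *)
Lemma Fq_mid (R : realType) (p : nat) (q : R) (A B : 'M[R]_p) : q < 1 ->
  pdmx A -> pdmx B -> Fq q B <= Fq q A -> Fq q B <= Fq q (mid A B).
Proof.
move=> q1 pA pB BA; have pC := pdmx_mid (pdmx_psdmx pA) pB.
have h1 := Fq_tangent q1 pC pA; have h2 := Fq_tangent q1 pC pB.
have : \tr (mxpowr (mid A B) (q - 1) *m (A - mid A B)) +
    \tr (mxpowr (mid A B) (q - 1) *m (B - mid A B)) = 0.
  rewrite -linearD -mulmxDr /=.
  have -> : A - mid A B + (B - mid A B) = 0.
    by apply/matrixP => i j; rewrite !mxE; field.
  by rewrite mulmx0 linear0.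
lra.
Qed.

Section Relaxation.
Variables (R : realType) (n m : nat) (g : 'I_m -> mpoly n R) (r : R) (jb : 'I_m).
Hypothesis ball : g jb = ballpoly n r.
Implicit Types (y z : mseq R n) (a b : multinom n).

Lemma vhalf_ballpoly : (vhalf (ballpoly n r) <= 1)%N.
Proof.
rewrite /vhalf /pdeg; suff : (msize (ballpoly n r) <= 3)%N.
  by case: (msize _) => [|[|[|[|]]]].
apply: leq_trans (mmeasureD_le _ _ _) _; rewrite geq_max mmeasureN; apply/andP; split.
  by rewrite mmeasureC; case: (_ != _).
apply: leq_trans (mmeasure_sum _ _ _ _) _; apply/bigmax_leqP => i _.
by rewrite mpolyXn msizeX mdegMn mdeg1.
Qed.

Lemma sdp_bound k y : y mnm0 = 1 -> psdmx (momentmx k y) ->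
  (forall j, (vhalf (g j) <= k)%N -> psdmx (locmx (k - vhalf (g j)) (g j) y)) ->
  forall a, (mdeg a <= k)%N -> `|y a| <= `|r| ^+ mdeg a.
Proof.
move=> y1 /psdmx_momentmx My Mg; apply: moment_bound => // s sk.
(* At order 0 the ball constraint may be absent, but then the only test polynomial is zero. *)
have [k0|k0] := posnP k.
  have -> : s = 0 by apply/eqP; rewrite -msize_poly_eq0 -leqn0 -k0.
  by rewrite expr0n mulr0 raddf0.
have v1 : (vhalf (g jb) <= 1)%N by rewrite ball vhalf_ballpoly.
rewrite -ball; move: (Mg jb (leq_trans v1 k0)) => /psdmx_locmx; apply.
by apply: leq_trans sk _; rewrite -subSn ?(leq_trans v1) // leq_subRL ?(leq_trans v1) // addnC -addn1 leq_add2l.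
Qed.

Lemma state_sdp_feasible d delta y z : state g z ->
  (forall a, (mdeg a <= 2 * d)%N -> z a = y a) -> sdp_feasible g d delta y.
Proof.
move=> [_ zp zg] zy; exists z; split=> //; split.
  by apply/psdmx_momentmx => s _; exact: zp.
by move=> j _; apply/psdmx_locmx => s _; exact: zg.
Qed.

(** Each moment is bounded, and each positivity test available, as soon as the order [d + delta] is
    large enough; the limits of the lifted sequences thus form a state. *)
Lemma sdp_limit (U : set_system nat) {UU : UltraFilter U} d (ys : nat -> mseq R n) :
  \oo `<=` U -> (forall delta, sdp_feasible g d delta (ys delta)) ->
  (forall delta, normalized (ys delta)) ->
  exists z, state g z /\
    forall a, (mdeg a <= 2 * d)%N -> (fun delta => ys delta a) @ U --> z a.
Proof.
move=> sU /choice [yd hyd] y1.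
have ydE delta a : (mdeg a <= 2 * d)%N -> yd delta a = ys delta a := proj1 (hyd delta) a.
have M0 delta := proj1 (proj2 (hyd delta)); have Mg delta := proj2 (proj2 (hyd delta)).
have yd1 delta : yd delta mnm0 = 1 by rewrite ydE ?mdeg0 // y1.
have ev N : U [set delta | (N <= delta)%N] by apply: sU; exact: nbhs_infty_ge.
have /choice [z zz] a : exists l : R, (fun delta => yd delta a) @ U --> l.
  apply: (@cvg_ultra_bounded _ _ _ _ (`|r| ^+ mdeg a)); apply: filterS (ev (mdeg a)).
  move=> delta /= ad; apply: (sdp_bound (yd1 delta) (M0 delta) (Mg delta)).
  by apply: leq_trans ad _; rewrite leq_addl.
exists z; split; last first.
  move=> a ad; apply: rcvg_near (zz a).
  by apply: filterS filterT => delta _ /=; rewrite ydE.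
split.
- by apply: (rcvg_eq (zz mnm0)); apply: filterS filterT => delta _ /=.
- move=> s; apply: (rcvg_ge (Lf_cvg (s ^+ 2) zz)); apply: filterS (ev (msize s)).
  move=> delta /= sd; move: (M0 delta) => /psdmx_momentmx; apply.
  by apply: leq_trans sd _; rewrite leqW // leq_addl.
- move=> j s; apply: (rcvg_ge (Lf_cvg (g j * s ^+ 2) zz)).
  apply: filterS (ev (msize s + vhalf (g j))%N) => delta /= sd.
  have vd : (vhalf (g j) <= d + delta)%N.
    by apply: leq_trans (leq_trans (leq_addl _ _) sd) _; rewrite leq_addl.
  move: (Mg delta j vd) => /psdmx_locmx; apply; apply: leqW.
  rewrite leq_subRL // addnC; apply: leq_trans sd _; exact: leq_addl.
Qed.

Lemma state_mid y z : state g y -> state g z -> state g (fun a => (y a + z a) / 2).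
Proof.
move=> [y1 yp yg] [z1 zp zg].
have LE p : Lf (fun a => (y a + z a) / 2) p = (Lf y p + Lf z p) / 2.
  rewrite /Lf -big_split mulr_suml; apply: eq_bigr => a _ /=; ring.
split; first by rewrite y1 z1; field.
  by move=> s; rewrite LE divr_ge0 // addr_ge0.
by move=> j s; rewrite LE divr_ge0 // addr_ge0.
Qed.

Lemma momentmx_eq d y z : (forall a, (mdeg a <= 2 * d)%N -> y a = z a) ->
  momentmx d y = momentmx d z.
Proof.
move=> yz; apply/matrixP => i j; rewrite !mxE; apply: yz.
by rewrite mdegD mul2n -addnn leq_add // midx_le.
Qed.

Lemma momentmx_mid d y z :
  momentmx d (fun a => (y a + z a) / 2) = mid (momentmx d y) (momentmx d z).
Proof. by apply/matrixP => i j; rewrite !mxE mulrC. Qed.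

Lemma multinom_split a t : (t <= mdeg a)%N ->
  exists b c, a = mnm_add b c /\ mdeg b = t.
Proof.
elim: t => [|t IH] ta; first by exists mnm0, a; rewrite add0m mdeg0.
have [b [c [aE bt]]] := IH (ltnW ta).
have /mdeg_gt0_split [i [c' cE]] : (0 < mdeg c)%N.
  by move: ta; rewrite aE mdegD bt -[t.+1]addn1 leq_add2l.
exists (mnm_add b (mnm1 i)), c'; split; first by rewrite aE cE addmA.
by rewrite mdegD mdeg1 bt addn1.
Qed.

(** Every exponent of degree at most [2 * d] is a sum of two of degree at most [d], so its moment is
    an entry of the matrix. *)
Lemma momentmx_inj d y z : momentmx d y = momentmx d z ->
  forall a, (mdeg a <= 2 * d)%N -> y a = z a.
Proof.
move=> yz a ad.
have [b [c [-> bd cd]]] : exists b c, [/\ a = mnm_add b c, (mdeg b <= d)%N & (mdeg c <= d)%N].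
  have [le|lt] := leqP (mdeg a) d.
    by exists a, mnm0; rewrite addm0 mdeg0.
  have [b [c [aE bd]]] := multinom_split (ltnW lt); exists b, c; split=> //.
    by rewrite bd.
  by move: ad; rewrite aE mdegD bd mul2n -addnn leq_add2l.
have [i <-] := midx_surj bd; have [j <-] := midx_surj cd.
by have /matrixP/(_ i j) := yz; rewrite !mxE.
Qed.

Lemma Lf_quadpoly d y (A : 'M[R]_(smon n d)) :
  Lf y (quadpoly A) = \tr (A *m momentmx d y).
Proof.
rewrite /quadpoly raddf_sum /=; apply: eq_bigr => i _; rewrite raddf_sum mxE /=.
by apply: eq_bigr => j _; rewrite LfZ -mpolyXD LfX mxE addmC.
Qed.

Lemma Psos_ge0 d delta yd p : in_Psos g d delta p ->
  psdmx (momentmx (d + delta) yd) ->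
  (forall j, (vhalf (g j) <= d + delta)%N ->
     psdmx (locmx (d + delta - vhalf (g j)) (g j) yd)) -> 0 <= Lf yd p.
Proof.
move=> [_ [s0 [s [[hs [hsz ->]] [hg ->]]]]] /psdmx_momentmx M0 Mg.
rewrite raddfD /= addr_ge0 // raddf_sum /=.
  by rewrite big_seq; apply: sumr_ge0 => h /hsz; exact: M0.
apply: sumr_ge0 => j _; have := hg j; case: ifP => [vd|_ ->]; last by rewrite mulr0 raddf0.
move=> [ts [tsz ->]]; rewrite mulr_sumr raddf_sum /= big_seq.
by apply: sumr_ge0 => h /tsz hz; move: (Mg j vd) => /psdmx_locmx; apply.
Qed.
End Relaxation.

Lemma smon_gt0 (n k : nat) : (0 < smon n k)%N.
Proof. by apply/card_gt0P; exists bm0. Qed.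

Theorem theorem3 (R : realType) (n d m : nat) (q : R)
  (g : 'I_m -> mpoly.mpoly n R)
  (ystar : mseq R n) (ys : nat -> mseq R n) :
  q < 1 ->
  (* X is compact with nonempty interior; one g_j is R0^2 - sum_i x_i^2 *)
  compact (semialg g) ->
  (interior (semialg g)) !=set0 ->
  (exists (j : 'I_m) (R0 : R),
      g j = mpoly.mpolyC n (R0 ^+ 2)
            - \sum_(i < n) mpoly.mpolyX R (mpoly.mnm1 i) ^+ 2) ->
  (* ystar is the (unique) optimal solution of the ideal problem *)
  is_moment_seq (semialg g) d ystar ->
  normalized ystar ->
  (forall z, is_moment_seq (semialg g) d z -> normalized z ->
     phiq q (momentmx d z) <= phiq q (momentmx d ystar)) ->
  (forall z, is_moment_seq (semialg g) d z -> normalized z ->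
     phiq q (momentmx d ystar) <= phiq q (momentmx d z) ->
     forall a, (mpoly.mdeg a <= 2 * d)%N -> z a = ystar a) ->
  (* ys delta is an optimal solution of the delta-th relaxation *)
  (forall delta, sdp_feasible g d delta (ys delta)) ->
  (forall delta, normalized (ys delta)) ->
  (forall delta z, sdp_feasible g d delta z -> normalized z ->
     phiq q (momentmx d z) <= phiq q (momentmx d (ys delta))) ->
  (* known positive definiteness of the optimal moment matrices *)
  pdmx (momentmx d ystar) ->
  (forall delta, pdmx (momentmx d (ys delta))) ->
  let pstar_d := quadpoly (mxpowr (momentmx d ystar) (q - 1)) in
  let p_dd := fun delta => quadpoly (mxpowr (momentmx d (ys delta)) (q - 1)) in
  (* (a) rho_delta -> rho *)
  ((fun delta => phiq q (momentmx d (ys delta))) @ \oo -->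
      phiq q (momentmx d ystar)) /\
  (* (b) moment convergence *)
  (forall a, (mpoly.mdeg a <= 2 * d)%N ->
      (fun delta => ys delta a) @ \oo --> ystar a) /\
  (* (c) coefficientwise convergence of the polynomials *)
  (forall a, (fun delta => mpoly.mcoeff a (p_dd delta)) @ \oo -->
      mpoly.mcoeff a pstar_d) /\
  (* (d) finite convergence under the SOS certificate *)
  (forall delta,
     in_Psos g d delta
       (mpoly.mpolyC n (\tr (mxpowr (momentmx d ystar) q)) - pstar_d) ->
     (forall a, (mpoly.mdeg a <= 2 * d)%N -> ys delta a = ystar a) /\
     is_moment_seq (semialg g) d (ys delta)).
Proof.
move=> q1 cX intX [jb [r ball]] ystarM ystar1 _ ystarU ysF ys1 ysO pdstar pdys pstar_d p_dd.
have X0 : semialg g !=set0 by case: intX => x /interior_subset; exists x.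
have N0 := smon_gt0 n d.
(* The state [e] extends [ystar] to all orders, so [ystar] is feasible for every relaxation. *)
have [e [eS eE]] := moment_seq_state cX ystarM ystar1.
have FqO delta : Fq q (momentmx d ystar) <= Fq q (momentmx d (ys delta)).
  rewrite -phiq_le //; apply: ysO => //; exact: state_sdp_feasible eS eE.
have limU (U : set_system nat) : UltraFilter U -> \oo `<=` U ->
    forall a, (mdeg a <= 2 * d)%N -> (fun delta => ys delta a) @ U --> ystar a.
  move=> UU sU; have [z [zS zz]] := sdp_limit ball sU ysF ys1.
  pose y a := (z a + e a) / 2.
  have yS : state g y := state_mid zS eS.
  have yM : is_moment_seq (semialg g) d y := state_is_moment_seq ball cX X0 d yS.
  have MyE : momentmx d y = mid (momentmx d z) (momentmx d ystar).
    by rewrite momentmx_mid (momentmx_eq eE).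
  have pdy : pdmx (momentmx d y).
    rewrite MyE; apply: pdmx_mid => //.
    by case: zS => _ zp _; apply/psdmx_momentmx => s _; exact: zp.
  (* [momentmx d z] is only known to be positive semidefinite; averaging with [ystar] before the
     limit keeps the limit positive definite, where [Fq] is continuous. *)
  pose C delta := mid (momentmx d (ys delta)) (momentmx d ystar).
  have pdC delta : pdmx (C delta) by apply: pdmx_mid => //; exact: pdmx_psdmx.
  have CC : mxcvg U C (momentmx d y).
    move=> i j; rewrite MyE !mxE; under eq_fun do rewrite !mxE.
    apply: cvgM; first exact: cvg_cst.
    apply: cvgD; last exact: cvg_cst.
    by apply: zz; rewrite mdegD mul2n -addnn leq_add // midx_le.
  have Fy : Fq q (momentmx d ystar) <= Fq q (momentmx d y).
    have FC : (fun delta => Fq q (C delta)) @ U --> Fq q (momentmx d y) by exact: Fq_cvg.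
    apply: (rcvg_ge FC); apply: filterS filterT => delta _ /=.
    exact: Fq_mid.
  have yE a : (mdeg a <= 2 * d)%N -> y a = ystar a.
    by apply: ystarU => //; [case: yS|rewrite phiq_le].
  move=> a ad; suff <- : z a = ystar a by exact: zz.
  have := yE a ad; rewrite /y eE // => h; lra.
have limM U : UltraFilter U -> \oo `<=` U ->
    mxcvg U (fun delta => momentmx d (ys delta)) (momentmx d ystar).
  move=> UU sU i j; rewrite mxE; under eq_fun do rewrite mxE.
  by apply: limU => //; rewrite mdegD mul2n -addnn leq_add // midx_le.
split.
  by apply: cvg_ultra_infty => U UU sU; apply: phiq_cvg => //; exact: limM.
split.
  by move=> a ad; apply: cvg_ultra_infty => U UU sU; exact: limU.
split.
  move=> a; apply: cvg_ultra_infty => U UU sU.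
  have quadE (A : 'M[R]_(smon n d)) : mcoeff a (quadpoly A) = \sum_i \sum_j A i j *
      mcoeff a (mpolyX R (midx i) * mpolyX R (midx j)).
    rewrite raddf_sum; apply: eq_bigr => i _; rewrite raddf_sum; apply: eq_bigr => j _.
    exact: mcoeffZ.
  rewrite /pstar_d quadE; under eq_fun do rewrite quadE.
  apply: rcvg_sum => i _; apply: rcvg_sum => j _; apply: cvgM; last exact: cvg_cst.
  by apply: mxpowr_cvg => //; exact: limM.
move=> delta hsos; have [yd [ydE [M0 Mg]]] := ysF delta.
(* The lifted functional is nonnegative on the certificate, which has degree at most [2 * d] and so
   sees only the moments of [ys delta]. *)
have tr_le : \tr (mxpowr (momentmx d ystar) (q - 1) *m
    (momentmx d (ys delta) - momentmx d ystar)) <= 0.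
  have := Psos_ge0 hsos M0 Mg; rewrite raddfB /= LfC Lf_quadpoly.
  rewrite ydE ?mdeg0 // ys1 mulr1 (momentmx_eq ydE) subr_ge0.
  by rewrite mulmxBr linearB /= mxpowr_mul_tr // subr_le0.
(* Optimality of [ys delta] bounds its [Fq] below by that of [ystar], so the tangent inequality is
   an equality. *)
have ysE : momentmx d ystar = momentmx d (ys delta).
  apply: (Fq_tangent_eq q1) => //; apply: le_trans (FqO delta).
  by rewrite gerDl.
have yE a : (mdeg a <= 2 * d)%N -> ys delta a = ystar a.
  by move=> ad; rewrite (momentmx_inj ysE).
split=> //; case: ystarM => mu muE; exists mu => a ad; rewrite yE //; exact: muE.
Qed.
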